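(* Let $\mathcal{P}=He_1\oplus He_2$ be the free left $H$-module of rank two with basis $e_1,e_2$, equipped with an $H$-pseudoalgebra structure such that $e_{1}\ast e_{1}=0$ and $e_{2}\ast e_{2}=0$ (and $e_1\ast e_2$, $e_2\ast e_1$ are arbitrary elements of $(H\otimes H)\otimes_H\mathcal{P}$). Then $\mathcal{P}$ is a left pre-Lie $H$-pseudoalgebra if and only if it is of one of the following types: (1) $e_{1}\ast e_{2}=0$, $e_{2}\ast e_{1}=0$; (2) $e_{1}\ast e_{2}=0$, $e_{2}\ast e_{1}=g\otimes1\otimes_{H}e_{1}$ for some nonzero $g\in H$ (any nonzero $g$ is allowed); (3) $e_{1}\ast e_{2}=h\otimes1\otimes_{H}e_{2}$, $e_{2}\ast e_{1}=0$ for some nonzero $h\in H$ (any nonzero $h$ is allowed).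
   Context: $\mathbf{k}$ is an algebraically closed field of characteristic $0$, $\delta$ is a finite-dimensional Lie algebra over $\mathbf{k}$, and $H=U(\delta)$ is its universal enveloping algebra with the standard cocommutative Hopf structure ($\Delta(x)=x\otimes1+1\otimes x$ for $x\in\delta$). We regard $\mathbf{k},\delta\subset H$. $H^{\otimes n}$ is a right $H$-module via the iterated coproduct, e.g. $(f\otimes g)\cdot h=(f\otimes g)\Delta(h)$. An $H$-pseudoalgebra is a left $H$-module $A$ with a map $\ast:A\otimes A\to(H\otimes H)\otimes_H A$ that is $H$-bilinear: $hx\ast gy=(h\otimes g\otimes_H1)(x\ast y)$ for $x,y\in A$, $h,g\in H$. For $\beta\in H\otimes H$ and $x\ast y=\sum_i\alpha_i\otimes_Hc_i$ one sets, in $H^{\otimes3}\otimes_HA$, $(\beta\otimes_Hx)\ast y=\sum_i(\beta\otimes1)(\Delta\otimes\mathrm{id})(\alpha_i)\otimes_Hc_i$ and $x\ast(\beta\otimes_Hy)=\sum_i(1\otimes\beta)(\mathrm{id}\otimes\Delta)(\alpha_i)\otimes_Hc_i$. $A$ is left pre-Lie if for all $x,y,z\in A$ $$(x\ast y)\ast z-x\ast(y\ast z)=((12)\otimes_H\mathrm{id})[(y\ast x)\ast z-y\ast(x\ast z)],$$ where $(12)(f\otimes h\otimes g)=h\otimes f\otimes g$. Conventions: $f\otimes g\otimes_He$ means $(f\otimes g)\otimes_He$. By $H$-bilinearity a pseudoproduct on a free module is determined by its values on basis elements. *)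

(* Defs.v *)
From HB Require Import structures.
From mathcomp Require Import all_boot all_order all_algebra.
From mathcomp Require Import boolp.

Set Implicit Arguments.
Unset Strict Implicit.
Unset Printing Implicit Defensive.

Import GRing.Theory.
Local Open Scope ring_scope.
Local Open Scope quotient_scope.

Reserved Notation "A ⊗ B" (at level 40, left associativity).
Reserved Notation "s ⊗H n" (at level 40, left associativity).

(* The right [R]-action of an [(S, R)]-bimodule [M]. *)
Record bimodule (S R : pzRingType) (M : lmodType S) := Bimodule {
  ract : M -> R -> M;
  ractDl : forall m m' r, ract (m + m') r = ract m r + ract m' r;
  ractDr : forall m r r', ract m (r + r') = ract m r + ract m r';
  ract1 : forall m, ract m 1 = m;
  ractM : forall m r r', ract m (r * r') = ract (ract m r) r';
  ractZ : forall s m r, s *: ract m r = ract (s *: m) r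
}.

(* [M (x)_R N] is presented as the commutative monoid of formal sums of symbols
   [(m, n)] modulo the congruence [tens_eq]; it is a group because
   [(m, n) + (- m, n)] reduces to [(0, n)], hence to the empty sum. *)
Section Tensor.
Variables (S R : pzRingType) (M : lmodType S) (rho : bimodule R M).
Variable N : lmodType R.

Inductive tens_eq : seq (M * N) -> seq (M * N) -> Prop :=
| te_refl s : tens_eq s s
| te_sym s t : tens_eq s t -> tens_eq t s
| te_trans s t u : tens_eq s t -> tens_eq t u -> tens_eq s u
| te_cat s s' t t' : tens_eq s s' -> tens_eq t t' -> tens_eq (s ++ t) (s' ++ t')
| te_catC s t : tens_eq (s ++ t) (t ++ s)
| te_addl m m' n : tens_eq [:: (m + m', n)] [:: (m, n); (m', n)]
| te_addr m n n' : tens_eq [:: (m, n + n')] [:: (m, n); (m, n')]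
| te_mid m r n : tens_eq [:: (ract rho m r, n)] [:: (m, r *: n)]
| te_0l n : tens_eq [:: (0, n)] [::].

Definition tens_rel : rel (seq (M * N)) := fun s t => `[< tens_eq s t >].

Fact tens_rel_equiv : equiv_class_of tens_rel.
Proof.
split.
- by move=> s; apply/asboolP; exact: te_refl.
- by move=> s t; apply/asboolP/asboolP; exact: te_sym.
- by move=> t s u /asboolP st /asboolP tu; apply/asboolP; exact: te_trans tu.
Qed.

Canonical tens_rel_equivRel := EquivRelPack tens_rel_equiv.

Definition tens := {eq_quot tens_rel}.
HB.instance Definition _ := Choice.on tens.
HB.instance Definition _ := EqQuotient.on tens.

Definition tsum (s : seq (M * N)) : tens := \pi_tens s.
Definition tpure (m : M) (n : N) : tens := tsum [:: (m, n)].

Lemma tsumP s t : tsum s = tsum t <-> tens_eq s t.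
Proof.
split=> [/eqmodP/asboolP //|st]; by apply/eqmodP/asboolP.
Qed.

Lemma tsum_repr (x : tens) : tsum (repr x) = x.
Proof. exact: reprK. Qed.

Definition tens_add (x y : tens) : tens := tsum (repr x ++ repr y).
Definition tens_map (f : M -> M) (x : tens) : tens :=
  tsum [seq (f p.1, p.2) | p <- repr x].
Definition tens_opp : tens -> tens := tens_map -%R.
Definition tens_scale (s : S) : tens -> tens := tens_map ( *:%R s).

Lemma tens_addE s t : tens_add (tsum s) (tsum t) = tsum (s ++ t).
Proof. by apply/tsumP/te_cat; apply/tsumP; rewrite tsum_repr. Qed.

Lemma tens_mapE (f : M -> M) s :
    {morph f : x y / x + y} -> (forall m r, f (ract rho m r) = ract rho (f m) r) ->
  tens_map f (tsum s) = tsum [seq (f p.1, p.2) | p <- s].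
Proof.
move=> fD fr.
have f0 : f 0 = 0.
  by have := fD 0 0; rewrite addr0 => /esym/eqP; rewrite -subr_eq0 addrK => /eqP.
apply/tsumP.
have: tens_eq (repr (tsum s)) s by apply/tsumP; rewrite tsum_repr.
move: (repr _) => s'; elim=> {s s'} /=.
- by move=> s; exact: te_refl.
- by move=> s t _; exact: te_sym.
- by move=> s t u _ st _; exact: te_trans st.
- by move=> s s' t t' _ ss' _ tt'; rewrite !map_cat; exact: te_cat.
- by move=> s t; rewrite !map_cat; exact: te_catC.
- by move=> m m' n; rewrite fD; exact: te_addl.
- by move=> m n n'; exact: te_addr.
- by move=> m r n; rewrite fr; exact: te_mid.
- by move=> n; rewrite f0; exact: te_0l.
Qed.

Lemma ractN m r : ract rho (- m) r = - ract rho m r.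
Proof. by rewrite -scaleN1r -ractZ scaleN1r. Qed.

Lemma tens_oppE s : tens_opp (tsum s) = tsum [seq (- p.1, p.2) | p <- s].
Proof. by apply: tens_mapE => [m m'|m r]; rewrite ?opprD ?ractN. Qed.

Lemma tens_scaleE a s : tens_scale a (tsum s) = tsum [seq (a *: p.1, p.2) | p <- s].
Proof. by apply: tens_mapE => [m m'|m r]; rewrite ?scalerDr ?ractZ. Qed.

Fact tens_addA : associative tens_add.
Proof.
move=> x y z; rewrite -[x]tsum_repr -[y]tsum_repr -[z]tsum_repr.
by rewrite !tens_addE catA.
Qed.
Fact tens_addC : commutative tens_add.
Proof. by move=> x y; apply/tsumP/te_catC. Qed.
Fact tens_add0 : left_id (tsum [::]) tens_add.
Proof. by move=> x; rewrite -[x]tsum_repr tens_addE. Qed.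
Fact tens_addN : left_inverse (tsum [::]) tens_opp tens_add.
Proof.
move=> x; rewrite -[x]tsum_repr tens_oppE tens_addE; apply/tsumP.
elim: (repr x) => [|[m n] s IHs] /=; first exact: te_refl.
set s' := map _ s in IHs *.
apply: (te_trans (t := [:: (- m, n); (m, n)] ++ (s' ++ s))).
  change (tens_eq ([:: (- m, n)] ++ (s' ++ ([:: (m, n)] ++ s)))
            ([:: (- m, n)] ++ ([:: (m, n)] ++ (s' ++ s)))).
  apply: te_cat (te_refl _) _; rewrite !catA.
  by apply: te_cat (te_refl _); exact: te_catC.
apply: (te_cat (s' := [::]) _ IHs).
by apply: te_trans (te_sym (te_addl _ _ _)) _; rewrite addNr; exact: te_0l.
Qed.

HB.instance Definition _ :=
  GRing.isZmodule.Build tens tens_addA tens_addC tens_add0 tens_addN.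

Lemma tsumD s t : tsum (s ++ t) = tsum s + tsum t.
Proof. by rewrite -tens_addE. Qed.
Lemma tsum0 : tsum [::] = 0. Proof. by []. Qed.

Lemma tsumE s : tsum s = \sum_(p <- s) tpure p.1 p.2.
Proof.
elim: s => [|[m n] s IHs]; first by rewrite big_nil.
by rewrite big_cons -IHs -cat1s tsumD.
Qed.

Lemma tpureDl m m' n : tpure (m + m') n = tpure m n + tpure m' n.
Proof. by rewrite -tsumD; apply/tsumP/te_addl. Qed.
Lemma tpureDr m n n' : tpure m (n + n') = tpure m n + tpure m n'.
Proof. by rewrite -tsumD; apply/tsumP/te_addr. Qed.
Lemma tpureM m r n : tpure (ract rho m r) n = tpure m (r *: n).
Proof. by apply/tsumP/te_mid. Qed.

Fact tens_scaleA a b x : tens_scale a (tens_scale b x) = tens_scale (a * b) x.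
Proof.
rewrite -[x]tsum_repr !tens_scaleE -map_comp; congr tsum.
by apply: eq_map => p /=; rewrite scalerA.
Qed.
Fact tens_scale1 : left_id 1 tens_scale.
Proof.
move=> x; rewrite -[RHS]tsum_repr -{1}[x]tsum_repr tens_scaleE; congr tsum.
by rewrite -[RHS]map_id; apply: eq_map => -[m n] /=; rewrite scale1r.
Qed.
Fact tens_scaleDr : right_distributive tens_scale +%R.
Proof.
move=> a x y; rewrite -[x]tsum_repr -[y]tsum_repr -tsumD !tens_scaleE.
by rewrite map_cat tsumD.
Qed.
Fact tens_scaleDl x : {morph tens_scale^~ x : a b / a + b}.
Proof.
move=> a b; rewrite -[x]tsum_repr !tens_scaleE.
elim: (repr x) => [|[m n] s IHs] /=; first by rewrite addr0.
rewrite -![_ :: map _ _]cat1s !tsumD IHs -!/(tpure _ _) scalerDl tpureDl.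
by rewrite addrACA.
Qed.

HB.instance Definition _ := GRing.Zmodule_isLmodule.Build S tens
  tens_scaleA tens_scale1 tens_scaleDr tens_scaleDl.

Lemma tpureZ a m n : a *: tpure m n = tpure (a *: m) n.
Proof. exact: tens_scaleE. Qed.

Lemma tens_ind (P : tens -> Prop) :
    P 0 -> (forall x y, P x -> P y -> P (x + y)) -> (forall m n, P (tpure m n)) ->
  forall x, P x.
Proof.
move=> P0 PD Pp x; rewrite -[x]tsum_repr tsumE.
by elim/big_ind: _ => // -[m n] _; exact: Pp.
Qed.

Definition balanced (Z : zmodType) (f : M -> N -> Z) :=
  [/\ forall m m' n, f (m + m') n = f m n + f m' n,
      forall m n n', f m (n + n') = f m n + f m n'
    & forall m r n, f (ract rho m r) n = f m (r *: n)].

(* Only meaningful when [f] is balanced. *)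
Definition tlift (Z : zmodType) (f : M -> N -> Z) (x : tens) : Z :=
  \sum_(p <- repr x) f p.1 p.2.

Section Lift.
Variables (Z : zmodType) (f : M -> N -> Z).
Hypothesis bf : balanced f.

Lemma tlift_tsum s : tlift f (tsum s) = \sum_(p <- s) f p.1 p.2.
Proof.
case: bf => fDl fDr fm; rewrite /tlift.
have f0 n : f 0 n = 0.
  by have := fDl 0 0 n; rewrite addr0 => /esym/eqP; rewrite -subr_eq0 addrK => /eqP.
have: tens_eq (repr (tsum s)) s by apply/tsumP; rewrite tsum_repr.
move: (repr _) => s'; elim=> {s s'} //=.
- by move=> s t u _ -> _ ->.
- by move=> s s' t t' _ E1 _ E2; rewrite !big_cat /= E1 E2.
- by move=> s t; rewrite !big_cat /= addrC.
- by move=> m m' n; rewrite !big_cons !big_nil /= !addr0 fDl.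
- by move=> m n n'; rewrite !big_cons !big_nil /= !addr0 fDr.
- by move=> m r n; rewrite !big_cons !big_nil /= fm.
- by move=> n; rewrite !big_cons !big_nil /= f0 addr0.
Qed.

Lemma tlift_pure m n : tlift f (tpure m n) = f m n.
Proof. by rewrite tlift_tsum big_cons big_nil addr0. Qed.

Lemma tliftD x y : tlift f (x + y) = tlift f x + tlift f y.
Proof.
rewrite -[x]tsum_repr -[y]tsum_repr -tsumD !tlift_tsum.
by rewrite big_cat.
Qed.

Lemma tlift0 : tlift f 0 = 0.
Proof. by rewrite -tsum0 tlift_tsum big_nil. Qed.

Lemma tlift_unique (g : tens -> Z) :
    {morph g : x y / x + y} -> (forall m n, g (tpure m n) = f m n) ->
  forall x, g x = tlift f x.
Proof.
move=> gD gE; apply: tens_ind => [|x y gx gy|m n].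
- rewrite tlift0; have := gD 0 0.
  by rewrite addr0 => /esym/eqP; rewrite -subr_eq0 addrK => /eqP.
- by rewrite gD tliftD gx gy.
- by rewrite gE tlift_pure.
Qed.
End Lift.
End Tensor.

Lemma zmod_morphism0 (U V : zmodType) (f : U -> V) :
  {morph f : x y / x + y} -> f 0 = 0.
Proof. by move/(_ 0 0); rewrite addr0 => /esym/eqP; rewrite -subr_eq0 addrK => /eqP. Qed.

(* The bimodules used below: a [k]-module for commutative [k], and the
   [(S, R)]-bimodule [S] attached to a ring morphism [R -> S]. *)
Definition scalar_bimodule (k : comPzRingType) (V : lmodType k) : bimodule k V.
Proof.
exists (fun v c => c *: v).
- by move=> v w c; exact: scalerDr.
- by move=> v c d; exact: scalerDl.
- exact: scale1r.
- by move=> v c d; rewrite scalerA mulrC.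
- by move=> c v d; rewrite !scalerA mulrC.
Defined.

Definition morphism_bimodule (R S : pzRingType) (phi : {rmorphism R -> S}) :
  bimodule R S^o.
Proof.
exists (fun (s : S) (r : R) => s * phi r).
- by move=> s t r; exact: mulrDl.
- by move=> s r r'; rewrite rmorphD mulrDr.
- by move=> s; rewrite rmorph1 mulr1.
- by move=> s r r'; rewrite rmorphM mulrA.
- by move=> s t r; exact: mulrA.
Defined.

Definition ktens (k : fieldType) (U V : lmodType k) : Type :=
  tens (scalar_bimodule U) V.
HB.instance Definition _ (k : fieldType) (U V : lmodType k) :=
  GRing.Lmodule.on (ktens U V).

Definition kpure (k : fieldType) (U V : lmodType k) (u : U) (v : V) : ktens U V :=
  tpure (scalar_bimodule U) u v.

Notation "A ⊗ B" := (ktens A%type B%type) : type_scope.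
Notation "a ⊗ b" := (kpure a b) : ring_scope.

Section KTens.
Variables (k : fieldType) (U V : lmodType k).

Lemma kpureDl (u u' : U) (v : V) : (u + u') ⊗ v = u ⊗ v + u' ⊗ v.
Proof. exact: tpureDl. Qed.
Lemma kpureDr (u : U) (v v' : V) : u ⊗ (v + v') = u ⊗ v + u ⊗ v'.
Proof. exact: tpureDr. Qed.
Lemma kpureZl c (u : U) (v : V) : (c *: u) ⊗ v = c *: (u ⊗ v).
Proof. by rewrite /kpure -tpureZ. Qed.
Lemma kpureZr c (u : U) (v : V) : u ⊗ (c *: v) = c *: (u ⊗ v).
Proof. by rewrite -kpureZl /kpure -tpureM. Qed.
Lemma kpure0r (u : U) : u ⊗ (0 : V) = 0.
Proof. exact: zmod_morphism0 (kpureDr u). Qed.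
Lemma ktens_ind (P : U ⊗ V -> Prop) :
    P 0 -> (forall x y, P x -> P y -> P (x + y)) -> (forall u v, P (u ⊗ v)) ->
  forall x, P x.
Proof. exact: tens_ind. Qed.

Definition bilin (W : lmodType k) (f : U -> V -> W) :=
  [/\ forall u u' v, f (u + u') v = f u v + f u' v,
      forall u v v', f u (v + v') = f u v + f u v',
      forall c u v, f (c *: u) v = c *: f u v
    & forall c u v, f u (c *: v) = c *: f u v].

Definition klift (W : lmodType k) (f : U -> V -> W) : U ⊗ V -> W :=
  @tlift _ _ _ (scalar_bimodule U) V W f.

Section Lift.
Variables (W : lmodType k) (f : U -> V -> W).
Hypothesis bf : bilin f.

Lemma bilin_balanced : balanced (scalar_bimodule U) f.
Proof. by case: bf => fDl fDr fZl fZr; split=> // u c v /=; rewrite fZl fZr. Qed.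

Lemma klift_pure u v : klift f (u ⊗ v) = f u v.
Proof. exact/tlift_pure/bilin_balanced. Qed.

Lemma kliftD x y : klift f (x + y) = klift f x + klift f y.
Proof. exact/tliftD/bilin_balanced. Qed.

Lemma klift0 : klift f 0 = 0.
Proof. exact/tlift0/bilin_balanced. Qed.

Lemma kliftZ c x : klift f (c *: x) = c *: klift f x.
Proof.
elim/ktens_ind: x => [|x y IHx IHy|u v].
- by rewrite scaler0 klift0 scaler0.
- by rewrite scalerDr !kliftD IHx IHy scalerDr.
- by rewrite -kpureZl !klift_pure; case: bf.
Qed.

Lemma klift_linear : linear (klift f).
Proof. by move=> c x y; rewrite kliftD kliftZ. Qed.
End Lift.

Lemma ktens_ext (W : zmodType) (f g : U ⊗ V -> W) :
    {morph f : x y / x + y} -> {morph g : x y / x + y} ->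
    (forall u v, f (u ⊗ v) = g (u ⊗ v)) ->
  f =1 g.
Proof.
move=> fD gD fg; elim/ktens_ind => [|x y fgx fgy|//].
  by rewrite !zmod_morphism0.
by rewrite fD gD fgx fgy.
Qed.
End KTens.

(* [algType] requires [1 != 0]; the augmentation (for [U g], the counit) gives
   it for tensor products without choosing bases. *)
HB.mixin Record hasAugmentation (k : fieldType) A of GRing.Algebra k A := {
  aug : A -> k;
  aug_linear : linear_for *%R aug;
  aug_monoid : monoid_morphism aug
}.

#[short(type="augAlgType")]
HB.structure Definition AugAlgebra (k : fieldType) :=
  {A of hasAugmentation k A & GRing.Algebra k A}.

Section AugTheory.
Variables (k : fieldType) (A : augAlgType k).
Lemma augD (x y : A) : aug (x + y) = aug x + aug y.
Proof. by have := aug_linear 1 x y; rewrite scale1r mul1r. Qed.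
Lemma aug0 : aug (0 : A) = 0.
Proof. exact: zmod_morphism0 augD. Qed.
Lemma augZ c (x : A) : aug (c *: x) = c * aug x.
Proof. by have := aug_linear c x 0; rewrite aug0 !addr0. Qed.
Lemma augM (x y : A) : aug (x * y) = aug x * aug y.
Proof. exact: aug_monoid.2. Qed.
Lemma aug1 : aug (1 : A) = 1.
Proof. exact: aug_monoid.1. Qed.
End AugTheory.

Section TensorAlgebra.
Variables (k : fieldType) (A B : augAlgType k).

Definition ktens_mul (x y : A ⊗ B) : A ⊗ B :=
  klift (fun a b => klift (fun a' b' => (a * a') ⊗ (b * b')) y) x.

Lemma mul_bilin a b : bilin (fun (a' : A) (b' : B) => (a * a') ⊗ (b * b')).
Proof.
split=> *; rewrite ?mulrDr ?kpureDl ?kpureDr // -scalerAr ?kpureZl ?kpureZr //.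
Qed.

Lemma mul_bilin2 y : bilin (fun (a : A) (b : B) =>
   klift (fun a' b' => (a * a') ⊗ (b * b')) y).
Proof.
split=> *; elim/ktens_ind: y => [|y y' IHy IHy'|a' b'];
  rewrite ?(klift0 (mul_bilin _ _)) ?(kliftD (mul_bilin _ _))
    ?(klift_pure (mul_bilin _ _)) ?addr0 ?scaler0 ?IHy ?IHy' ?scalerDr //.
- by rewrite addrACA.
- by rewrite mulrDl kpureDl.
- by rewrite addrACA.
- by rewrite mulrDl kpureDr.
- by rewrite -scalerAl kpureZl.
- by rewrite -scalerAl kpureZr.
Qed.

Lemma ktens_mulE a b a' b' :
  ktens_mul (a ⊗ b) (a' ⊗ b') = (a * a') ⊗ (b * b').
Proof. by rewrite /ktens_mul (klift_pure (mul_bilin2 _)) (klift_pure (mul_bilin _ _)). Qed.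

Fact ktens_mulDl : left_distributive ktens_mul +%R.
Proof. by move=> x y z; rewrite /ktens_mul (kliftD (mul_bilin2 _)). Qed.
Fact ktens_mulDr : right_distributive ktens_mul +%R.
Proof.
move=> x y z; elim/ktens_ind: x => [|x x' IHx IHx'|a b].
- by rewrite /ktens_mul !(klift0 (mul_bilin2 _)) addr0.
- by rewrite !ktens_mulDl IHx IHx' addrACA.
- by rewrite /ktens_mul !(klift_pure (mul_bilin2 _)) (kliftD (mul_bilin _ _)).
Qed.
Lemma ktens_mul0l x : ktens_mul 0 x = 0.
Proof. exact: (zmod_morphism0 (fun y z => ktens_mulDl y z x)). Qed.
Lemma ktens_mul0r x : ktens_mul x 0 = 0.
Proof. exact: (zmod_morphism0 (fun y z => ktens_mulDr x y z)). Qed.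

Fact ktens_mulA : associative ktens_mul.
Proof.
move=> x y z; elim/ktens_ind: x => [|x x' IHx IHx'|a b].
- by rewrite !ktens_mul0l.
- by rewrite !ktens_mulDl IHx IHx'.
elim/ktens_ind: y => [|y y' IHy IHy'|a' b'].
- by rewrite ktens_mul0r !ktens_mul0l ktens_mul0r.
- by rewrite ktens_mulDl !ktens_mulDr IHy IHy' ktens_mulDl.
elim/ktens_ind: z => [|z z' IHz IHz'|a'' b''].
- by rewrite !ktens_mul0r.
- by rewrite !ktens_mulDr IHz IHz'.
by rewrite !ktens_mulE !mulrA.
Qed.
Fact ktens_mul1l : left_id (1 ⊗ 1) ktens_mul.
Proof.
elim/ktens_ind => [|x x' IHx IHx'|a b]; first by rewrite ktens_mul0r.
  by rewrite ktens_mulDr IHx IHx'.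
by rewrite ktens_mulE !mul1r.
Qed.
Fact ktens_mul1r : right_id (1 ⊗ 1) ktens_mul.
Proof.
elim/ktens_ind => [|x x' IHx IHx'|a b]; first by rewrite ktens_mul0l.
  by rewrite ktens_mulDl IHx IHx'.
by rewrite ktens_mulE !mulr1.
Qed.

HB.instance Definition _ := GRing.Zmodule_isPzRing.Build (A ⊗ B)%type
  ktens_mulA ktens_mul1l ktens_mul1r ktens_mulDl ktens_mulDr.

Lemma kpureM (a a' : A) (b b' : B) : (a ⊗ b) * (a' ⊗ b') = (a * a') ⊗ (b * b').
Proof. exact: ktens_mulE. Qed.
Lemma kpure1 : 1 = 1 ⊗ 1 :> A ⊗ B. Proof. by []. Qed.

Fact ktens_scalerAl (c : k) (x y : A ⊗ B) : c *: (x * y) = (c *: x) * y.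
Proof.
elim/ktens_ind: x => [|x x' IHx IHx'|a b].
- by rewrite scaler0 !mul0r scaler0.
- by rewrite mulrDl !scalerDr IHx IHx' mulrDl.
elim/ktens_ind: y => [|y y' IHy IHy'|a' b'].
- by rewrite !mulr0 scaler0.
- by rewrite !mulrDr scalerDr IHy IHy'.
by rewrite -kpureZl !kpureM -scalerAl kpureZl.
Qed.
Fact ktens_scalerAr (c : k) (x y : A ⊗ B) : c *: (x * y) = x * (c *: y).
Proof.
elim/ktens_ind: y => [|y y' IHy IHy'|a' b'].
- by rewrite scaler0 !mulr0 scaler0.
- by rewrite mulrDr !scalerDr IHy IHy' mulrDr.
elim/ktens_ind: x => [|x x' IHx IHx'|a b].
- by rewrite !mul0r scaler0.
- by rewrite !mulrDl scalerDr IHx IHx'.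
by rewrite -kpureZl !kpureM -scalerAr kpureZl.
Qed.

(* A ring morphism out of a tensor product may be checked on pure tensors. *)
Lemma ktens_multP (C : pzRingType) (f : A ⊗ B -> C) :
    {morph f : x y / x + y} ->
    (forall a b a' b', f ((a * a') ⊗ (b * b')) = f (a ⊗ b) * f (a' ⊗ b')) ->
    f (1 ⊗ 1) = 1 ->
  monoid_morphism f.
Proof.
move=> fD fM f1; have f0 := zmod_morphism0 fD; split=> // x y.
elim/ktens_ind: x => [|x x' IHx IHx'|a b].
- by rewrite mul0r f0 mul0r.
- by rewrite mulrDl !fD IHx IHx' mulrDl.
elim/ktens_ind: y => [|y y' IHy IHy'|a' b'].
- by rewrite mulr0 f0 mulr0.
- by rewrite mulrDr !fD IHy IHy' mulrDr.
by rewrite kpureM fM.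
Qed.
End TensorAlgebra.

Section TensorAugAlgebra.
Variables (k : fieldType) (A B : augAlgType k).

Definition ktens_aug : A ⊗ B -> k :=
  klift (W := k^o) (fun a b => aug a * aug b).
Lemma ktens_aug_bilin : bilin (W := k^o) (fun (a : A) (b : B) => aug a * aug b).
Proof.
split=> *; rewrite ?augD ?augZ ?mulrDl ?mulrDr //.
- by rewrite -mulrA.
- by rewrite mulrCA.
Qed.
Lemma ktens_augE a b : ktens_aug (a ⊗ b) = aug a * aug b.
Proof. exact: klift_pure ktens_aug_bilin _ _. Qed.
Fact ktens_aug_linear : linear_for *%R ktens_aug.
Proof. exact: klift_linear ktens_aug_bilin. Qed.
Fact ktens_aug_monoid : monoid_morphism ktens_aug.
Proof.
apply: ktens_multP => [x y|a b a' b'|].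
- exact: kliftD ktens_aug_bilin _ _.
- by rewrite !ktens_augE !augM mulrACA.
- by rewrite ktens_augE !aug1 mulr1.
Qed.
Fact ktens_neq0 : 1 != 0 :> A ⊗ B.
Proof.
apply/eqP => /(congr1 ktens_aug); rewrite ktens_aug_monoid.1.
rewrite [RHS](klift0 ktens_aug_bilin) => /eqP.
by rewrite oner_eq0.
Qed.

HB.instance Definition _ := GRing.PzSemiRing_isNonZero.Build (A ⊗ B)%type ktens_neq0.
HB.instance Definition _ := GRing.Lmodule_isLalgebra.Build k (A ⊗ B)%type
  (@ktens_scalerAl k A B).
HB.instance Definition _ := GRing.Lalgebra_isAlgebra.Build k (A ⊗ B)%type
  (@ktens_scalerAr k A B).
HB.instance Definition _ := hasAugmentation.Build k (A ⊗ B)%type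
  ktens_aug_linear ktens_aug_monoid.
End TensorAugAlgebra.

Section TensorMaps.
Variable k : fieldType.

Section Map.
Variables (U V U' V' : lmodType k) (f : {linear U -> U'}) (g : {linear V -> V'}).
Definition tmap : U ⊗ V -> U' ⊗ V' := klift (fun u v => f u ⊗ g v).
Lemma tmap_bilin : bilin (fun u v => f u ⊗ g v).
Proof. by split=> *; rewrite ?linearD ?linearZ ?kpureDl ?kpureDr ?kpureZl ?kpureZr. Qed.
Lemma tmapE u v : tmap (u ⊗ v) = f u ⊗ g v.
Proof. exact: klift_pure tmap_bilin _ _. Qed.
HB.instance Definition _ := GRing.isLinear.Build k (U ⊗ V)%type (U' ⊗ V')%type *:%R tmap
  (klift_linear tmap_bilin).
End Map.

Section Swap.
Variables U V : lmodType k.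
Definition tswap : U ⊗ V -> V ⊗ U := klift (fun u v => v ⊗ u).
Lemma tswap_bilin : bilin (fun (u : U) (v : V) => v ⊗ u).
Proof. by split=> *; rewrite ?kpureDl ?kpureDr ?kpureZl ?kpureZr. Qed.
Lemma tswapE u v : tswap (u ⊗ v) = v ⊗ u.
Proof. exact: klift_pure tswap_bilin _ _. Qed.
HB.instance Definition _ := GRing.isLinear.Build k (U ⊗ V)%type (V ⊗ U)%type *:%R tswap
  (klift_linear tswap_bilin).
End Swap.

Section Assoc.
Variables U V W : lmodType k.
Definition tassoc : U ⊗ (V ⊗ W) -> (U ⊗ V) ⊗ W :=
  klift (fun u t => klift (fun v w => (u ⊗ v) ⊗ w) t).
Lemma tassoc_bilin1 (u : U) : bilin (fun (v : V) (w : W) => (u ⊗ v) ⊗ w).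
Proof. by split=> *; rewrite ?(kpureDl, kpureDr, kpureZl, kpureZr). Qed.
Lemma tassoc_bilin : bilin (fun (u : U) (t : V ⊗ W) =>
  klift (fun v w => (u ⊗ v) ⊗ w) t).
Proof.
split.
- move=> u u'; elim/ktens_ind=> [|t t' IHt IHt'|v w].
  + by rewrite !(klift0 (tassoc_bilin1 _)) addr0.
  + by rewrite !(kliftD (tassoc_bilin1 _)) IHt IHt' addrACA.
  + by rewrite !(klift_pure (tassoc_bilin1 _)) !kpureDl.
- by move=> u t t'; rewrite (kliftD (tassoc_bilin1 _)).
- move=> c u; elim/ktens_ind=> [|t t' IHt IHt'|v w].
  + by rewrite !(klift0 (tassoc_bilin1 _)) scaler0.
  + by rewrite !(kliftD (tassoc_bilin1 _)) IHt IHt' scalerDr.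
  + by rewrite !(klift_pure (tassoc_bilin1 _)) !kpureZl.
- by move=> c u t; rewrite (kliftZ (tassoc_bilin1 _)).
Qed.
Lemma tassocE u v w : tassoc (u ⊗ (v ⊗ w)) = (u ⊗ v) ⊗ w.
Proof. by rewrite /tassoc (klift_pure tassoc_bilin) (klift_pure (tassoc_bilin1 _)). Qed.
HB.instance Definition _ := GRing.isLinear.Build k (U ⊗ (V ⊗ W))%type
  ((U ⊗ V) ⊗ W)%type *:%R tassoc (klift_linear tassoc_bilin).
End Assoc.

Section AlgebraMaps.
Variables A B A' B' : augAlgType k.

Section Map.
Variables (f : {linear A -> A'}) (g : {linear B -> B'}).
Hypotheses (fM : monoid_morphism f) (gM : monoid_morphism g).
Lemma tmap_monoid : monoid_morphism (tmap f g).
Proof.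
apply: ktens_multP => [x y|a b a' b'|]; first exact: linearD.
  by rewrite !tmapE kpureM fM.2 gM.2.
by rewrite tmapE fM.1 gM.1.
Qed.
End Map.

Lemma tswap_monoid : monoid_morphism (@tswap A B).
Proof.
apply: ktens_multP => [x y|a b a' b'|]; first exact: linearD.
  by rewrite !tswapE kpureM.
by rewrite tswapE.
Qed.
End AlgebraMaps.

Section AlgebraAssoc.
Variables A B C : augAlgType k.
Lemma tassoc_monoid : monoid_morphism (@tassoc A B C).
Proof.
apply: ktens_multP => [x y|a t a' t'|]; first exact: linearD.
  elim/ktens_ind: t => [|t1 t2 IH1 IH2|b c].
  - by rewrite mul0r !kpure0r !linear0 mul0r.
  - by rewrite mulrDl !kpureDr !linearD /= mulrDl IH1 IH2.
  elim/ktens_ind: t' => [|t1 t2 IH1 IH2|b' c'].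
  - by rewrite mulr0 !kpure0r !linear0 mulr0.
  - by rewrite mulrDr !kpureDr !linearD /= mulrDr IH1 IH2.
  by rewrite kpureM !tassocE !kpureM.
by rewrite [X in _ ⊗ X]kpure1 tassocE.
Qed.
End AlgebraAssoc.
End TensorMaps.

HB.instance Definition _ (k : fieldType) (A B A' B' : augAlgType k)
    (f : {lrmorphism A -> A'}) (g : {lrmorphism B -> B'}) :=
  GRing.isMonoidMorphism.Build (A ⊗ B)%type (A' ⊗ B')%type (tmap f g)
    (tmap_monoid (conj (rmorph1 f) (rmorphM f)) (conj (rmorph1 g) (rmorphM g))).
HB.instance Definition _ (k : fieldType) (A B : augAlgType k) :=
  GRing.isMonoidMorphism.Build (A ⊗ B)%type (B ⊗ A)%type (@tswap k A B)
    (@tswap_monoid k A B).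
HB.instance Definition _ (k : fieldType) (A B C : augAlgType k) :=
  GRing.isMonoidMorphism.Build (A ⊗ (B ⊗ C))%type ((A ⊗ B) ⊗ C)%type
    (@tassoc k A B C) (@tassoc_monoid k A B C).

HB.mixin Record isLieAlgebra (k : fieldType) g of GRing.Lmodule k g := {
  lie : g -> g -> g;
  lie_linearl : forall y, linear (lie^~ y);
  lie_linearr : forall x, linear (lie x);
  lie_alternating : forall x, lie x x = 0;
  lie_jacobi : forall x y z,
    lie x (lie y z) + lie y (lie z x) + lie z (lie x y) = 0
}.

#[short(type="lieAlgType")]
HB.structure Definition LieAlgebra (k : fieldType) :=
  {g of isLieAlgebra k g & GRing.Lmodule k g}.

#[short(type="finLieAlgType")]
HB.structure Definition FinLieAlgebra (k : fieldType) :=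
  {g of LieAlgebra k g & Vector k g}.

(* [U g]: the unital associative [k]-algebra presented by generators [gen x],
   for [x] in [g], linear in [x], and relations
   [gen x * gen y = gen y * gen x + gen (lie x y)]. *)
Section Enveloping.
Variables (k : fieldType) (g : lieAlgType k).

Inductive uexp :=
| UGen of g
| UZero
| UOne
| UOpp of uexp
| UAdd of uexp & uexp
| UMul of uexp & uexp
| UScale of k & uexp.

HB.instance Definition _ := gen_eqMixin uexp.
HB.instance Definition _ := gen_choiceMixin uexp.

Inductive ueq : uexp -> uexp -> Prop :=
| ue_refl a : ueq a a
| ue_sym a b : ueq a b -> ueq b a
| ue_trans a b c : ueq a b -> ueq b c -> ueq a c
| ue_opp a a' : ueq a a' -> ueq (UOpp a) (UOpp a')
| ue_add a a' b b' : ueq a a' -> ueq b b' -> ueq (UAdd a b) (UAdd a' b')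
| ue_mul a a' b b' : ueq a a' -> ueq b b' -> ueq (UMul a b) (UMul a' b')
| ue_scale c a a' : ueq a a' -> ueq (UScale c a) (UScale c a')
| ue_addA a b c : ueq (UAdd a (UAdd b c)) (UAdd (UAdd a b) c)
| ue_addC a b : ueq (UAdd a b) (UAdd b a)
| ue_add0 a : ueq (UAdd UZero a) a
| ue_addN a : ueq (UAdd (UOpp a) a) UZero
| ue_mulA a b c : ueq (UMul a (UMul b c)) (UMul (UMul a b) c)
| ue_mul1l a : ueq (UMul UOne a) a
| ue_mul1r a : ueq (UMul a UOne) a
| ue_mulDl a b c : ueq (UMul (UAdd a b) c) (UAdd (UMul a c) (UMul b c))
| ue_mulDr a b c : ueq (UMul a (UAdd b c)) (UAdd (UMul a b) (UMul a c))
| ue_scaleA c d a : ueq (UScale c (UScale d a)) (UScale (c * d) a)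
| ue_scale1 a : ueq (UScale 1 a) a
| ue_scaleDr c a b : ueq (UScale c (UAdd a b)) (UAdd (UScale c a) (UScale c b))
| ue_scaleDl c d a : ueq (UScale (c + d) a) (UAdd (UScale c a) (UScale d a))
| ue_scaleAl c a b : ueq (UScale c (UMul a b)) (UMul (UScale c a) b)
| ue_scaleAr c a b : ueq (UScale c (UMul a b)) (UMul a (UScale c b))
| ue_genD x y : ueq (UGen (x + y)) (UAdd (UGen x) (UGen y))
| ue_genZ c x : ueq (UGen (c *: x)) (UScale c (UGen x))
| ue_lie x y :
    ueq (UMul (UGen x) (UGen y)) (UAdd (UMul (UGen y) (UGen x)) (UGen (lie x y))).

Definition urel : rel uexp := fun a b => `[< ueq a b >].

Fact urel_equiv : equiv_class_of urel.
Proof.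
split.
- by move=> a; apply/asboolP; exact: ue_refl.
- by move=> a b; apply/asboolP/asboolP; exact: ue_sym.
- by move=> b a c /asboolP ab /asboolP bc; apply/asboolP; exact: ue_trans bc.
Qed.

Canonical urel_equivRel := EquivRelPack urel_equiv.

Definition U := {eq_quot urel}.
HB.instance Definition _ := Choice.on U.
HB.instance Definition _ := EqQuotient.on U.

Definition uclass (a : uexp) : U := \pi_U a.

Lemma uclassP a b : uclass a = uclass b <-> ueq a b.
Proof. by split=> [/eqmodP/asboolP //|ab]; apply/eqmodP/asboolP. Qed.
Lemma uclass_repr (x : U) : uclass (repr x) = x.
Proof. exact: reprK. Qed.

Definition u_add (x y : U) : U := uclass (UAdd (repr x) (repr y)).
Definition u_opp (x : U) : U := uclass (UOpp (repr x)).
Definition u_mul (x y : U) : U := uclass (UMul (repr x) (repr y)).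
Definition u_scale (c : k) (x : U) : U := uclass (UScale c (repr x)).

Lemma u_addE a b : u_add (uclass a) (uclass b) = uclass (UAdd a b).
Proof. by apply/uclassP/ue_add; apply/uclassP/uclass_repr. Qed.
Lemma u_oppE a : u_opp (uclass a) = uclass (UOpp a).
Proof. by apply/uclassP/ue_opp; apply/uclassP/uclass_repr. Qed.
Lemma u_mulE a b : u_mul (uclass a) (uclass b) = uclass (UMul a b).
Proof. by apply/uclassP/ue_mul; apply/uclassP/uclass_repr. Qed.
Lemma u_scaleE c a : u_scale c (uclass a) = uclass (UScale c a).
Proof. by apply/uclassP/ue_scale; apply/uclassP/uclass_repr. Qed.
Definition uE := (u_addE, u_oppE, u_mulE, u_scaleE).

Fact u_addA : associative u_add.
Proof.
move=> x y z; rewrite -[x]uclass_repr -[y]uclass_repr -[z]uclass_repr !uE.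
exact/uclassP/ue_addA.
Qed.
Fact u_addC : commutative u_add.
Proof. by move=> x y; apply/uclassP/ue_addC. Qed.
Fact u_add0 : left_id (uclass UZero) u_add.
Proof. by move=> x; rewrite -[x]uclass_repr uE; apply/uclassP/ue_add0. Qed.
Fact u_addN : left_inverse (uclass UZero) u_opp u_add.
Proof. by move=> x; rewrite -[x]uclass_repr !uE; apply/uclassP/ue_addN. Qed.
HB.instance Definition _ := GRing.isZmodule.Build U u_addA u_addC u_add0 u_addN.

Fact u_mulA : associative u_mul.
Proof.
move=> x y z; rewrite -[x]uclass_repr -[y]uclass_repr -[z]uclass_repr !uE.
exact/uclassP/ue_mulA.
Qed.
Fact u_mul1l : left_id (uclass UOne) u_mul.
Proof. by move=> x; rewrite -[x]uclass_repr uE; apply/uclassP/ue_mul1l. Qed.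
Fact u_mul1r : right_id (uclass UOne) u_mul.
Proof. by move=> x; rewrite -[x]uclass_repr uE; apply/uclassP/ue_mul1r. Qed.
Fact u_mulDl : left_distributive u_mul +%R.
Proof.
move=> x y z; rewrite -[x]uclass_repr -[y]uclass_repr -[z]uclass_repr.
rewrite -[_ + _]/(u_add _ _) -[RHS]/(u_add _ _) !uE; exact/uclassP/ue_mulDl.
Qed.
Fact u_mulDr : right_distributive u_mul +%R.
Proof.
move=> x y z; rewrite -[x]uclass_repr -[y]uclass_repr -[z]uclass_repr.
rewrite -[_ + _]/(u_add _ _) -[RHS]/(u_add _ _) !uE; exact/uclassP/ue_mulDr.
Qed.
HB.instance Definition _ := GRing.Zmodule_isPzRing.Build U
  u_mulA u_mul1l u_mul1r u_mulDl u_mulDr.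

Fact u_scaleA c d x : u_scale c (u_scale d x) = u_scale (c * d) x.
Proof. by rewrite -[x]uclass_repr !uE; apply/uclassP/ue_scaleA. Qed.
Fact u_scale1 : left_id 1 u_scale.
Proof. by move=> x; rewrite -[x]uclass_repr uE; apply/uclassP/ue_scale1. Qed.
Fact u_scaleDr : right_distributive u_scale +%R.
Proof.
move=> c x y; rewrite -[x]uclass_repr -[y]uclass_repr.
rewrite -[_ + _]/(u_add _ _) -[RHS]/(u_add _ _) !uE; exact/uclassP/ue_scaleDr.
Qed.
Fact u_scaleDl x : {morph u_scale^~ x : c d / c + d}.
Proof.
move=> c d; rewrite -[x]uclass_repr -[RHS]/(u_add _ _) !uE.
exact/uclassP/ue_scaleDl.
Qed.
HB.instance Definition _ := GRing.Zmodule_isLmodule.Build k U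
  u_scaleA u_scale1 u_scaleDr u_scaleDl.

Fixpoint ueval (A : algType k) (f : g -> A) (a : uexp) : A :=
  match a with
  | UGen x => f x
  | UZero => 0
  | UOne => 1
  | UOpp a => - ueval f a
  | UAdd a b => ueval f a + ueval f b
  | UMul a b => ueval f a * ueval f b
  | UScale c a => c *: ueval f a
  end.

(* Only meaningful when [f] is a [lie_morphism], see below. *)
Definition ulift (A : algType k) (f : g -> A) (x : U) : A := ueval f (repr x).

Definition lie_morphism (A : algType k) (f : g -> A) :=
  linear f /\ forall x y, f (lie x y) = f x * f y - f y * f x.

Section Lift.
Variables (A : algType k) (f : g -> A).
Hypothesis lf : lie_morphism f.

Lemma ulift_uclass a : ulift f (uclass a) = ueval f a.
Proof.
case: lf => fL fl.
have fD : {morph f : x y / x + y} by move=> x y; have := fL 1 x y; rewrite !scale1r.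
have fZ c x : f (c *: x) = c *: f x.
  by rewrite -[c *: x]addr0 fL (zmod_morphism0 fD) addr0.
have: ueq (repr (uclass a)) a by apply/uclassP/uclass_repr.
rewrite /ulift; move: (repr _) => b.
elim=> {a b} //=.
- by move=> a b c _ -> _ ->.
- by move=> a b _ ->.
- by move=> a a' b b' _ -> _ ->.
- by move=> a a' b b' _ -> _ ->.
- by move=> c a a' _ ->.
- by move=> a b c; exact: addrA.
- by move=> a b; exact: addrC.
- by move=> a; exact: add0r.
- by move=> a; exact: addNr.
- by move=> a b c; exact: mulrA.
- by move=> a; exact: mul1r.
- by move=> a; exact: mulr1.
- by move=> a b c; exact: mulrDl.
- by move=> a b c; exact: mulrDr.
- by move=> c d a; exact: scalerA.
- by move=> a; exact: scale1r.
- by move=> c a b; exact: scalerDr.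
- by move=> c d a; exact: scalerDl.
- by move=> c a b; exact: scalerAl.
- by move=> c a b; exact: scalerAr.
- by move=> x y; rewrite fl addrC subrK.
Qed.

Lemma ulift_linear : linear (ulift f).
Proof.
move=> c x y; rewrite -[x]uclass_repr -[y]uclass_repr.
rewrite -[_ *: _]/(u_scale _ _) -[_ + _ in LHS]/(u_add _ _) !uE !ulift_uclass //.
Qed.

Lemma ulift_monoid : monoid_morphism (ulift f).
Proof.
split; first exact: (ulift_uclass UOne).
move=> x y; rewrite -[x]uclass_repr -[y]uclass_repr.
by rewrite -[_ * _ in LHS]/(u_mul _ _) !uE !ulift_uclass.
Qed.
End Lift.

Lemma lie_morphism0 : lie_morphism (fun _ => 0 : k^o).
Proof. by split=> [c x y|x y]; rewrite ?scaler0 ?addr0 // mulr0 subr0. Qed.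

Definition ucounit : U -> k := ulift (A := k^o) (fun _ => 0).
Fact ucounit_linear : linear_for *%R ucounit.
Proof. exact: ulift_linear lie_morphism0. Qed.
Fact ucounit_monoid : monoid_morphism ucounit.
Proof. exact: ulift_monoid lie_morphism0. Qed.

Fact u_neq0 : 1 != 0 :> U.
Proof.
apply/eqP => /(congr1 ucounit); rewrite ucounit_monoid.1.
rewrite [RHS](ulift_uclass lie_morphism0 UZero) => /eqP.
by rewrite oner_eq0.
Qed.
Fact u_scalerAl (c : k) (x y : U) : c *: (x * y) = (c *: x) * y.
Proof.
rewrite -[x]uclass_repr -[y]uclass_repr.
rewrite -[_ * _]/(u_mul _ _) -[_ *: _]/(u_scale _ _) -[RHS]/(u_mul _ _).
rewrite -[_ *: _ in RHS]/(u_scale _ _) !uE; exact/uclassP/ue_scaleAl.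
Qed.
Fact u_scalerAr (c : k) (x y : U) : c *: (x * y) = x * (c *: y).
Proof.
rewrite -[x]uclass_repr -[y]uclass_repr.
rewrite -[_ * _]/(u_mul _ _) -[_ *: _]/(u_scale _ _) -[RHS]/(u_mul _ _).
rewrite -[_ *: _ in RHS]/(u_scale _ _) !uE; exact/uclassP/ue_scaleAr.
Qed.
HB.instance Definition _ := GRing.PzSemiRing_isNonZero.Build U u_neq0.
HB.instance Definition _ := GRing.Lmodule_isLalgebra.Build k U u_scalerAl.
HB.instance Definition _ := GRing.Lalgebra_isAlgebra.Build k U u_scalerAr.
HB.instance Definition _ := hasAugmentation.Build k U ucounit_linear ucounit_monoid.

Definition gen (x : g) : U := uclass (UGen x).

Lemma gen_linear : linear gen.
Proof.
move=> c x y; rewrite /gen -[RHS]/(u_add (u_scale _ _) _) !uE; apply/uclassP.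
apply: ue_trans (ue_genD _ _) _; apply: ue_add; last exact: ue_refl.
exact: ue_genZ.
Qed.
HB.instance Definition _ := GRing.isLinear.Build k g U *:%R gen gen_linear.

Lemma gen_lie x y : gen (lie x y) = gen x * gen y - gen y * gen x.
Proof.
apply/eqP; rewrite eq_sym subr_eq addrC eq_sym; apply/eqP/esym.
rewrite /gen -[LHS]/(u_mul _ _) -[RHS]/(u_add (u_mul _ _) _) !uE.
exact/uclassP/ue_lie.
Qed.

Lemma ulift_gen (A : algType k) (f : g -> A) (lf : lie_morphism f) x :
  ulift f (gen x) = f x.
Proof. exact: ulift_uclass lf _. Qed.

Lemma u_ext (A : algType k) (f f' : {lrmorphism U -> A}) :
  (forall x, f (gen x) = f' (gen x)) -> f =1 f'.
Proof.
move=> ff' x; rewrite -[x]uclass_repr; elim: (repr x) => {x}.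
- exact: ff'.
- by rewrite -[uclass UZero]/(0 : U) !linear0.
- by rewrite -[uclass UOne]/(1 : U) !rmorph1.
- by move=> a IHa; rewrite -u_oppE -[u_opp _]/(- (_ : U)) !linearN /= IHa.
- by move=> a IHa b IHb; rewrite -u_addE -[u_add _ _]/((_ : U) + _) !linearD /= IHa IHb.
- by move=> a IHa b IHb; rewrite -u_mulE -[u_mul _ _]/((_ : U) * _) !rmorphM /= IHa IHb.
- by move=> c a IHa; rewrite -u_scaleE -[u_scale _ _]/(_ *: (_ : U)) !linearZ /= IHa.
Qed.

Definition comul : U -> U ⊗ U := ulift (fun x => gen x ⊗ 1 + 1 ⊗ gen x).

Lemma comul_lie : lie_morphism (fun x => gen x ⊗ 1 + 1 ⊗ gen x).
Proof.
split=> [c x y|x y].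
  by rewrite linearP kpureDl kpureDr kpureZl kpureZr scalerDr addrACA.
rewrite gen_lie kpureDl kpureDr !mulrDl !mulrDr !kpureM !mul1r !mulr1.
rewrite -!scaleN1r kpureZl kpureZr !scalerDr.
rewrite !scaleN1r; apply/esym; rewrite addrACA [X in X + _ = _]addrACA.
rewrite [X in _ + X = _]addrACA -!addrA; congr (_ + (_ + _)).
by rewrite !addrA subrK subrr add0r.
Qed.
HB.instance Definition _ := GRing.isLinear.Build k U (U ⊗ U)%type *:%R comul
  (ulift_linear comul_lie).
HB.instance Definition _ := GRing.isMonoidMorphism.Build U (U ⊗ U)%type comul
  (ulift_monoid comul_lie).

Lemma comul_gen x : comul (gen x) = gen x ⊗ 1 + 1 ⊗ gen x.
Proof. exact: ulift_gen comul_lie _. Qed.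

Lemma comul_cocomm x : tswap (comul x) = comul x.
Proof.
apply: (u_ext (f := @tswap k U U \o comul) (f' := comul)) => {}x /=.
by rewrite comul_gen linearD /= !tswapE addrC.
Qed.

Lemma comul_coassoc x :
  tassoc (tmap (@idfun U) comul (comul x)) = tmap comul (@idfun U) (comul x).
Proof.
apply: (u_ext (f := @tassoc k U U U \o (tmap (@idfun U) comul \o comul))
              (f' := tmap comul (@idfun U) \o comul)) => {}x /=.
rewrite comul_gen !linearD /= !tmapE /= !comul_gen [comul 1]rmorph1 kpure1.
by rewrite !kpureDl !kpureDr !linearD /= !tassocE addrA.
Qed.
End Enveloping.

(* [S (x)_R N] for a ring morphism [phi : R -> S], [r] acting on [S] on the
   right by [phi r]; it is a left [S]-module. *)
Section BaseChange.
Variables (R S : pzRingType) (phi : {rmorphism R -> S}).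
Variable N : lmodType R.

Definition base_change : Type := tens (morphism_bimodule phi) N.
HB.instance Definition _ := GRing.Lmodule.on base_change.
Definition bpure (s : S) (n : N) : base_change :=
  tpure (morphism_bimodule phi) (s : S^o) n.
Definition blift (Z : zmodType) (f : S -> N -> Z) : base_change -> Z :=
  @tlift _ _ _ (morphism_bimodule phi) N Z f.
End BaseChange.

Section BaseChangeMap.
Variables (R S S' : pzRingType).
Variables (phi : {rmorphism R -> S}) (phi' : {rmorphism R -> S'}).
Variable N : lmodType R.

(* [sigma (x)_R id]; meaningful when [sigma \o phi =1 phi']. *)
Definition bmap (sigma : S -> S') : base_change phi N -> base_change phi' N :=
  blift (fun s n => bpure phi' (sigma s) n).

Variable sigma : {rmorphism S -> S'}.
Hypothesis sigma_phi : forall r, sigma (phi r) = phi' r.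

Lemma bmap_balanced :
  balanced (morphism_bimodule phi) (fun s n => bpure phi' (sigma s) n : base_change phi' N).
Proof.
split.
- by move=> s s' n; rewrite /bpure -tpureDl -raddfD.
- by move=> s n n'; rewrite /bpure -tpureDr.
- by move=> s r n; rewrite /bpure /= -tpureM /= rmorphM sigma_phi.
Qed.

Lemma bmapE s n : bmap sigma (bpure phi s n) = bpure phi' (sigma s) n.
Proof. exact: tlift_pure bmap_balanced _ _. Qed.

Lemma bmapD u v : bmap sigma (u + v) = bmap sigma u + bmap sigma v.
Proof. exact: tliftD bmap_balanced _ _. Qed.

Lemma bmapZ s u : bmap sigma (s *: u) = sigma s *: bmap sigma u.
Proof.
elim/tens_ind: u => [|u v IHu IHv|t n].
- by rewrite scaler0 !(zmod_morphism0 bmapD) scaler0.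
- by rewrite scalerDr !bmapD IHu IHv scalerDr.
- rewrite -[tpure _ t n]/(bpure phi t n) [s *: _]tpureZ.
  by rewrite -[tpure _ _ n]/(bpure phi (s * t) n) !bmapE rmorphM /bpure tpureZ.
Qed.
End BaseChangeMap.

Section Pseudoalgebra.
Variables (k : fieldType) (g : lieAlgType k).
Local Notation H := (U g).
Local Notation H2 := (H ⊗ H)%type.
Local Notation H3 := (H ⊗ H ⊗ H)%type.

Definition comul2 : {rmorphism H -> H2} := @comul k g.
Definition comul_id : {rmorphism H2 -> H3} := tmap (@comul k g) (@idfun H).
Definition id_comul : {rmorphism H2 -> H3} :=
  @tassoc k H H H \o tmap (@idfun H) (@comul k g).
Definition comul3 : {rmorphism H -> H3} := comul_id \o comul2.
(* [f ⊗ h ⊗ g |-> h ⊗ f ⊗ g] *)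
Definition perm12 : {rmorphism H3 -> H3} := tmap (@tswap k H H) (@idfun H).

Section Module.
Variable A : lmodType H.

Definition tens2 : Type := base_change comul2 A.
Definition tens3 : Type := base_change comul3 A.
HB.instance Definition _ := GRing.Lmodule.on tens2.
HB.instance Definition _ := GRing.Lmodule.on tens3.

(* With biadditivity, the last axiom for [h], [f] in [k] is [k]-bilinearity,
   so this is an [H]-bilinear map defined on [A (x)_k A]. *)
Record pseudoproduct := Pseudoproduct {
  pprod :> A -> A -> tens2;
  pprodDl : forall x x' y, pprod (x + x') y = pprod x y + pprod x' y;
  pprodDr : forall x y y', pprod x (y + y') = pprod x y + pprod x y';
  pprodH : forall (h f : H) (x y : A),
    pprod (h *: x) (f *: y) = (h ⊗ f) *: pprod x y
}.

Variable p : pseudoproduct.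

(* [u * z] and [x * v] for [u], [v] in [(H (x) H) (x)_H A]: on pure tensors
   they are given by [pprod_lE] and [pprod_rE]. As [H3] is bracketed to the
   left, [1 (x) beta] is written [tassoc (1 ⊗ beta)]. *)
Definition pprod_l (u : tens2) (z : A) : tens3 :=
  blift (fun (beta : H2) (x : A) => (beta ⊗ 1) *: bmap comul3 comul_id (p x z)) u.
Definition pprod_r (x : A) (v : tens2) : tens3 :=
  blift (fun (beta : H2) (y : A) =>
    tassoc (1 ⊗ beta) *: bmap comul3 id_comul (p x y)) v.

Definition left_preLie := forall x y z : A,
  pprod_l (p x y) z - pprod_r x (p y z) =
  bmap comul3 perm12 (pprod_l (p y x) z - pprod_r y (p x z)).


Lemma comul_id_comul2 h : comul_id (comul2 h) = comul3 h.
Proof. by []. Qed.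
Lemma id_comul_comul2 h : id_comul (comul2 h) = comul3 h.
Proof. exact: comul_coassoc. Qed.
Lemma perm12_comul3 h : perm12 (comul3 h) = comul3 h.
Proof.
rewrite -comul_id_comul2; move: (comul2 h) => t.
apply: (ktens_ext (f := perm12 \o comul_id) (g := comul_id)) => [x y|x y|x y] /=.
- by rewrite !linearD.
- by rewrite linearD.
- by rewrite !tmapE /= comul_cocomm.
Qed.

Lemma pprodHl h x y : p (h *: x) y = (h ⊗ 1) *: p x y.
Proof. by rewrite -{1}[y]scale1r pprodH. Qed.
Lemma pprodHr h x y : p x (h *: y) = (1 ⊗ h) *: p x y.
Proof. by rewrite -{1}[x]scale1r pprodH. Qed.

Lemma pprod_l_balanced z :
  balanced (morphism_bimodule comul2) (fun (beta : H2) (x : A) =>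
    (beta ⊗ 1) *: bmap comul3 comul_id (p x z) : tens3).
Proof.
split=> [b b' x|b x x'|b h x] /=.
- by rewrite kpureDl scalerDl.
- by rewrite pprodDl (bmapD comul_id_comul2) scalerDr.
- rewrite pprodHl (bmapZ comul_id_comul2) scalerA; congr (_ *: _).
  by rewrite [comul_id _]tmapE kpureM mulr1.
Qed.

Lemma pprod_r_balanced x :
  balanced (morphism_bimodule comul2) (fun (beta : H2) (y : A) =>
    tassoc (1 ⊗ beta) *: bmap comul3 id_comul (p x y) : tens3).
Proof.
split=> [b b' y|b y y'|b h y] /=.
- by rewrite kpureDr linearD scalerDl.
- by rewrite pprodDr (bmapD id_comul_comul2) scalerDr.
- rewrite pprodHr (bmapZ id_comul_comul2) scalerA; congr (_ *: _).
  rewrite -[id_comul _]/(tassoc (tmap (@idfun H) (@comul k g) (1 ⊗ h))) tmapE /=.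
  by rewrite -rmorphM kpureM mulr1.
Qed.

Lemma pprod_lE beta x z :
  pprod_l (bpure comul2 beta x) z = (beta ⊗ 1) *: bmap comul3 comul_id (p x z).
Proof. exact: tlift_pure (pprod_l_balanced z) _ _. Qed.
Lemma pprod_rE x beta y :
  pprod_r x (bpure comul2 beta y) = tassoc (1 ⊗ beta) *: bmap comul3 id_comul (p x y).
Proof. exact: tlift_pure (pprod_r_balanced x) _ _. Qed.
Lemma pprod_lD u v z : pprod_l (u + v) z = pprod_l u z + pprod_l v z.
Proof. exact: tliftD (pprod_l_balanced z) _ _. Qed.
Lemma pprod_rD x u v : pprod_r x (u + v) = pprod_r x u + pprod_r x v.
Proof. exact: tliftD (pprod_r_balanced x) _ _. Qed.
End Module.
End Pseudoalgebra.

Notation "alpha ⊗H a" := (bpure (comul2 _) alpha a) : ring_scope.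

(* Main.v *)
From HB Require Import structures.
Require Import Defs.
From mathcomp Require Import all_boot all_algebra.
From mathcomp Require Import boolp classical_sets.

Set Implicit Arguments.
Unset Strict Implicit.
Unset Printing Implicit Defensive.

Import GRing.Theory.
Local Open Scope ring_scope.

(** Write e1 * e2 = a (x)_H e1 + b (x)_H e2 and
e2 * e1 = c (x)_H e1 + d (x)_H e2.  Comparing coefficients, the pre-Lie
identity on basis elements becomes a system of equations in H (x) H (x) H,
invariant under the exchange of e1 and e2 (that is, of a with d and of b with
c).  Subscripts name tensor factors, so that b_{1,23} is (id (x) Delta)(b) and
b_{12,3} is (Delta (x) id)(b).

- The triple (e1, e1, e2) makes b_{23} b_{1,23} invariant under (12).  Let n
  and m be the degrees of b in its two factors.  In the first factor the
  product has degree at most n, and its image under (12) has degree n + m;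
  hence m = 0, i.e. b = h (x) 1 ([invariant_square_pure]).  Exchanging e1 and
  e2, c = g (x) 1.
- The triple (e1, e2, e2) then gives
  a_{12} a_{12,3} = g_2 a_{12,3} - a_{13} g_2.  If a has degree n in its first
  factor, the left side has degree 2n there, whereas on the right the parts of
  degree n cancel; hence a = 0 ([mixed_coefficient_eq0]).  Exchanging, d = 0.
- The triple (e1, e2, e1) leaves (h (x) 1) Delta(g) = 0, whence h = 0 or g = 0
  ([pure_comul_eq0]).

The converse is a direct check: the associator is H-trilinear, so the identity
need only be verified on basis elements.

Everything rests on a degree on H that is additive on products and for which
Delta(h) = h (x) 1 + terms of lower degree in the first factor.  Instead of the
Poincare-Birkhoff-Witt theorem, the coradical filtration [corad] is used, with
top-degree parts observed through functionals.  A functional l with l(1) = 0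
acts on H by contraction of the first factor of Delta; the contraction lowers
the degree and is a derivation up to terms of lower degree, so that the
convolution powers of l satisfy
  l^(n + m) (f h) = C(n + m, n) l^n(f) l^m(h)
when f and h have degrees at most n and m ([cpowM]).  In characteristic 0,
every element of degree exactly n has l^n(f) <> 0 for some such l, by
polarization ([cpow_nonzero]), and one l serves two elements at once
([cpow_nonzero2]). *)

(** * Functionals and tensors over a field *)

Section Functionals.
Variable k : fieldType.

Definition subspace (V : lmodType k) (W : V -> Prop) :=
  W 0 /\ forall c x y, W x -> W y -> W (c *: x + y).

(** A maximal W-stable subset A avoiding v, given by Zorn's lemma, is a
hyperplane complementary to the line of v, and phi is the coordinate along v. *)
Lemma separating_functional (V : lmodType k) (W : V -> Prop) (v : V) :
    subspace W -> ~ W v ->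
  exists2 phi : {linear V -> k^o}, phi v = 1 & forall w, W w -> phi w = 0.
Proof.
move=> [W0 WP] Wv.
(* The empty set is allowed, so that unions of empty chains are good; a maximal
   good set is nonempty because W itself is good. *)
pose good (A : set V) := [/\ forall c x y, A x -> A y -> A (c *: x + y),
  forall x w, A x -> W w -> A (x + w) & ~ A v].
have good_union F : (F `<=` good)%classic -> total_on F subset ->
    good (\bigcup_(X in F) X)%classic.
  move=> Fgood Ftot; split.
  - move=> c x y [X FX Xx] [Y FY Yy].
    case: (Ftot _ _ FX FY) => [XY|YX].
      by exists Y => //; case: (Fgood Y FY) => YP _ _; apply: YP => //; exact: XY.
    by exists X => //; case: (Fgood X FX) => XP _ _; apply: XP => //; exact: YX.
  - move=> x w [X FX Xx] Ww; exists X => //.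
    by case: (Fgood X FX) => _ XP _; exact: XP.
  - by move=> [X FX Xv]; case: (Fgood X FX) => _ _; apply.
have [A [[AP AW Av] Amax]] := Zorn_bigcup good_union.
have A0 : A 0.
  apply: contrapT => nA0.
  have A_empty x : ~ A x.
    by move=> Ax; apply: nA0; have := AP (-1) x x Ax Ax; rewrite scaleN1r addNr.
  apply: (Amax W).
    by split=> [x /A_empty //|/(_ 0 W0) /nA0].
  split=> [c x y|x w Wx Ww|//]; first exact: WP.
  by have := WP 1 _ _ Wx Ww; rewrite scale1r.
have AZ c x : A x -> A (c *: x) by move=> Ax; rewrite -[_ *: _]addr0; exact: AP.
have AD x y : A x -> A y -> A (x + y) by move=> ? ?; rewrite -[x]scale1r; exact: AP.
have ex_coef x : exists c, A (x - c *: v).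
  have [Ax|nAx] := pselect (A x); first by exists 0; rewrite scale0r subr0.
  pose B : set V := fun y => exists d, A (y - d *: x).
  have Bv : B v.
    apply: contrapT => nBv; apply: (Amax B).
      split=> [y Ay|BA]; first by exists 0; rewrite scale0r subr0.
      by apply/nAx/BA; exists 1; rewrite scale1r subrr.
    split=> // [c y z [d Ad] [e Ae]|y w [d Ad] Ww].
      exists (c * d + e); rewrite scalerDl -scalerA opprD addrACA -scalerBr.
      exact: AP.
    by exists d; rewrite addrAC; exact: AW.
  case: Bv => d Ad.
  have d0 : d != 0.
    by apply/eqP => d0; apply: Av; rewrite d0 scale0r subr0 in Ad.
  exists d^-1; have := AZ (- d^-1) _ Ad.
  by rewrite scalerBr scalerA mulNr mulVf // !scaleNr scale1r opprK addrC.
have [phi phiP] := choice ex_coef.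
have phi_unique x c : A (x - c *: v) -> phi x = c.
  move=> Ac; apply/eqP; rewrite -subr_eq0; apply/negPn/negP => ne0.
  apply: Av; rewrite -[v]scale1r -(mulVf ne0) -scalerA; apply: AZ.
  have := AP (-1) _ _ (phiP x) Ac.
  by rewrite scaleN1r opprB addrA subrK scalerBl.
have phi_lin : linear (phi : V -> k^o).
  move=> c x y; apply: phi_unique.
  rewrite scalerDl opprD addrACA -scalerA -scalerBr; exact: AP.
pose phiM := GRing.isLinear.Build k V k^o *:%R phi phi_lin.
pose phiL : {linear V -> k^o} := HB.pack phi phiM.
exists phiL => [|w Ww]; apply: phi_unique; first by rewrite scale1r subrr.
by rewrite scale0r subr0 -[w]add0r; exact: AW.
Qed.

Section Slice.
Variables U V : lmodType k.

Definition slice (l : {linear U -> k^o}) : U ⊗ V -> V := klift (fun u v => l u *: v).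
Lemma slice_bilin (l : {linear U -> k^o}) : bilin (fun u (v : V) => (l u : k) *: v).
Proof.
split=> [u u' v|u v v'|c u v|c u v].
- by rewrite linearD scalerDl.
- by rewrite scalerDr.
- by rewrite linearZ; exact/esym/scalerA.
- by rewrite !scalerA mulrC.
Qed.
HB.instance Definition _ l :=
  GRing.isLinear.Build k (U ⊗ V)%type V *:%R (slice l) (klift_linear (slice_bilin l)).
Lemma sliceE l u v : slice l (u ⊗ v) = (l u : k) *: v.
Proof. exact: klift_pure (slice_bilin l) _ _. Qed.

Definition tfun (l : {linear U -> k^o}) (m : {linear V -> k^o}) : U ⊗ V -> k^o :=
  m \o slice l.
HB.instance Definition _ l m := GRing.Linear.on (tfun l m).
Lemma tfunE l m u v : tfun l m (u ⊗ v) = (l u : k) * m v.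
Proof. by rewrite /tfun /= sliceE linearZ. Qed.

(** The image of U ⊗ W in U ⊗ V, generated so that additive maps vanish on it
as soon as they vanish on u ⊗ w with w in W. *)
Inductive right_in (W : V -> Prop) : U ⊗ V -> Prop :=
| right_in0 : right_in W 0
| right_inD x y : right_in W x -> right_in W y -> right_in W (x + y)
| right_in_pure u v : W v -> right_in W (u ⊗ v).

Lemma right_inZ (W : V -> Prop) c x : right_in W x -> right_in W (c *: x).
Proof.
elim=> {x} [|x y _ IHx _ IHy|u v Wv]; first by rewrite scaler0; exact: right_in0.
  by rewrite scalerDr; exact: right_inD.
by rewrite -kpureZl; exact: right_in_pure.
Qed.

Lemma right_in_sum (W : V -> Prop) (I : Type) (r : seq I) (F : I -> U ⊗ V) :
  (forall i, right_in W (F i)) -> right_in W (\sum_(i <- r) F i).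
Proof.
move=> WF; elim: r => [|i r IHr]; first by rewrite big_nil; exact: right_in0.
by rewrite big_cons; exact: right_inD.
Qed.

Lemma right_in_mono (W W' : V -> Prop) x :
  (forall v, W v -> W' v) -> right_in W x -> right_in W' x.
Proof.
move=> WW'; elim=> {x} [|x y _ IHx _ IHy|u v Wv]; first exact: right_in0.
  exact: right_inD.
by apply: right_in_pure; exact: WW'.
Qed.

Lemma right_in_eq0 (Z : zmodType) (W : V -> Prop) (F : U ⊗ V -> Z) x :
    {morph F : y z / y + z} -> (forall u v, W v -> F (u ⊗ v) = 0) ->
  right_in W x -> F x = 0.
Proof.
move=> FD F0; elim=> {x} [|x y _ IHx _ IHy|u v Wv]; first exact: zmod_morphism0 FD.
  by rewrite FD IHx IHy addr0.
exact: F0.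
Qed.

Lemma right_in_slice (W : V -> Prop) l x :
  subspace W -> right_in W x -> W (slice l x).
Proof.
move=> [W0 WP]; elim=> {x} [|x y _ IHx _ IHy|u v Wv]; first by rewrite linear0.
  by rewrite linearD /= -[slice l x]scale1r; exact: WP.
by rewrite sliceE -[_ *: v]addr0; exact: WP.
Qed.

Lemma kpure_suml (I : Type) (r : seq I) (P : pred I) (F : I -> U) (v : V) :
  (\sum_(i <- r | P i) F i) ⊗ v = \sum_(i <- r | P i) F i ⊗ v.
Proof.
apply: (big_morph (fun u => u ⊗ v) (fun u u' => kpureDl u u' v)).
exact: zmod_morphism0 (fun u u' => kpureDl u u' v).
Qed.

Lemma kpure_sumr (I : Type) (r : seq I) (P : pred I) (u : U) (F : I -> V) :
  u ⊗ (\sum_(i <- r | P i) F i) = \sum_(i <- r | P i) u ⊗ F i.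
Proof. exact: (big_morph (fun v => u ⊗ v) (kpureDr u) (kpure0r _ u)). Qed.

Definition tensor_sum r (u : 'I_r -> U) (v : 'I_r -> V) : U ⊗ V :=
  \sum_(i < r) u i ⊗ v i.

End Slice.

(** The existence of such functionals expresses linear independence of [u]. *)
Definition dual_family (U : lmodType k) r (u : 'I_r -> U)
    (phi : 'I_r -> {linear U -> k^o}) :=
  forall i j, phi i (u j) = (i == j)%:R.

Lemma dual_family_or_span (U : lmodType k) r (u : 'I_r -> U) :
  (exists phi, dual_family u phi) \/
  exists (i : 'I_r) (d : 'I_r -> k), u i = \sum_(j | j != i) d j *: u j.
Proof.
pose W i x := exists d : 'I_r -> k, x = \sum_(j | j != i) d j *: u j.
have [[i [d uE]]|indep] := pselect (exists i, W i (u i)); first by right; exists i, d.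
left.
have ex_phi i : exists phi : {linear U -> k^o}, forall j, phi (u j) = (i == j)%:R.
  have [|Wui|phi phi1 phi0] := @separating_functional U (W i) (u i).
  - split=> [|c _ _ [d ->] [e ->]].
      by exists (fun=> 0); rewrite big1 // => j _; rewrite scale0r.
    exists (fun j => c * d j + e j); rewrite scaler_sumr -big_split.
    by apply: eq_bigr => j _; rewrite scalerDl scalerA.
  - by apply: indep; exists i.
  exists phi => j; have [<-|ij] := eqVneq i j; first exact: phi1.
  apply: phi0; exists (fun l => (j == l)%:R).
  rewrite (bigD1 j) 1?eq_sym //= eqxx scale1r big1 ?addr0 // => l /andP[_ lj].
  by rewrite eq_sym (negPf lj) scale0r.
have [phi phiP] := choice ex_phi; by exists phi.
Qed.

Lemma sum_neq_lift (V : zmodType) r (i : 'I_r.+1) (F : 'I_r.+1 -> V) :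
  \sum_(j | j != i) F j = \sum_j F (lift i j).
Proof.
rewrite big_mkcond (bigD1_ord i) //= eqxx add0r.
by apply: eq_bigr => j _; rewrite eq_sym neq_lift.
Qed.

(** An expression of minimal length has independent entries on both sides: a
linear relation on either side would allow one term to be absorbed by the
others. *)
Lemma tensor_normal_form (U V : lmodType k) (t : U ⊗ V) :
  exists r (u : 'I_r -> U) (v : 'I_r -> V) phi psi,
    [/\ t = tensor_sum u v, dual_family u phi & dual_family v psi].
Proof.
pose rep r := exists (u : 'I_r -> U) (v : 'I_r -> V), t = tensor_sum u v.
have ex_rep : exists r, `[< rep r >].
  exists (size (repr t)); apply/asboolP.
  exists (fun i => (tnth (in_tuple (repr t)) i).1).
  exists (fun i => (tnth (in_tuple (repr t)) i).2).
  by rewrite /tensor_sum -[LHS]tsum_repr tsumE big_tnth.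
case: (ex_minnP ex_rep) => r /asboolP [u [v tE]] r_min.
have not_shorter r' : r = r'.+1 -> ~ rep r'.
  by move=> rE /asboolP /r_min; rewrite rE ltnn.
exists r, u, v.
have [[phi phiP]|[i [d uE]]] := dual_family_or_span u; last first.
  case: r i u v d uE tE not_shorter {r_min} => [[] //|r] i u v d uE tE /(_ r erefl) [].
  exists (fun j => u (lift i j)), (fun j => v (lift i j) + d (lift i j) *: v i).
  rewrite tE /tensor_sum (bigD1_ord i) //= uE sum_neq_lift kpure_suml -big_split.
  by apply: eq_bigr => j _; rewrite kpureDr kpureZl kpureZr addrC.
have [[psi psiP]|[i [d vE]]] := dual_family_or_span v; last first.
  case: r i u v d vE tE not_shorter phi phiP {r_min}
    => [[] //|r] i u v d vE tE /(_ r erefl) [].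
  exists (fun j => u (lift i j) + d (lift i j) *: u i), (fun j => v (lift i j)).
  rewrite tE /tensor_sum (bigD1_ord i) //= vE sum_neq_lift kpure_sumr -big_split.
  by apply: eq_bigr => j _; rewrite kpureDl kpureZl kpureZr addrC.
by exists phi, psi.
Qed.

(** In a normal form each right entry is itself a slice. *)
Lemma right_in_of_slices (U V : lmodType k) (W : V -> Prop) (t : U ⊗ V) :
  (forall l, W (slice l t)) -> right_in W t.
Proof.
have [r [u [v [phi [_ [-> phiP _]]]]]] := tensor_normal_form t => Wt.
apply: right_in_sum => i; apply: right_in_pure.
have := Wt (phi i); rewrite /tensor_sum linear_sum (bigD1 i) //= sliceE phiP eqxx scale1r.
rewrite big1 ?addr0 // => j ji.
by rewrite sliceE phiP eq_sym (negPf ji) scale0r.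
Qed.
End Functionals.

(** * The coradical filtration of an enveloping algebra *)

Section Coradical.
Variables (k : fieldType) (g : lieAlgType k).
Local Notation H := (U g).
Local Notation H2 := (H ⊗ H)%type.

Lemma U_ind (P : H -> Prop) :
    (forall x, P (gen x)) -> P 1 -> (forall c a b, P a -> P b -> P (c *: a + b)) ->
    (forall a b, P a -> P b -> P (a * b)) ->
  forall h, P h.
Proof.
move=> Pg P1 PL PM h.
have P0 : P 0 by have := PL (-1) _ _ P1 P1; rewrite scaleN1r addNr.
rewrite -[h]uclass_repr; elim: (repr h) => {h}.
- exact: Pg.
- exact: P0.
- exact: P1.
- by move=> a IHa; have := PL (-1) _ _ IHa P0; rewrite addr0 scaleN1r -u_oppE.
- by move=> a IHa b IHb; have := PL 1 _ _ IHa IHb; rewrite scale1r -u_addE.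
- by move=> a IHa b IHb; have := PM _ _ IHa IHb; rewrite -[_ * _]/(u_mul _ _) u_mulE.
- by move=> c a IHa; have := PL c _ _ IHa P0; rewrite addr0 -[_ *: _]/(u_scale _ _) u_scaleE.
Qed.

Definition counit : H -> k^o := @aug k H.
Lemma counit_linear : linear counit.
Proof. exact: aug_linear. Qed.
HB.instance Definition _ := GRing.isLinear.Build k H k^o *:%R counit counit_linear.

Lemma counitM a b : counit (a * b) = counit a * counit b.
Proof. exact: (@augM k H a b). Qed.
Lemma counit1 : counit 1 = 1. Proof. exact: (@aug1 k H). Qed.

Lemma slice_counitM (x y : H2) :
  slice counit (x * y) = slice counit x * slice counit y.
Proof.
elim/ktens_ind: x => [|x x' IHx IHx'|a b].
- by rewrite mul0r !linear0 mul0r.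
- by rewrite mulrDl !linearD /= mulrDl IHx IHx'.
elim/ktens_ind: y => [|y y' IHy IHy'|a' b'].
- by rewrite mulr0 !linear0 mulr0.
- by rewrite mulrDr !linearD /= mulrDr IHy IHy'.
by rewrite kpureM !sliceE /= counitM -scalerAl -scalerAr scalerA.
Qed.

Lemma counit_gen x : counit (gen x) = 0.
Proof. exact: ulift_gen (lie_morphism0 g) x. Qed.

Lemma counit_comul h : slice counit (comul h) = h.
Proof.
elim/U_ind: h => [x||c a b IHa IHb|a b IHa IHb].
- by rewrite comul_gen linearD /= !sliceE /= counit_gen scale0r add0r counit1 scale1r.
- by rewrite rmorph1 kpure1 sliceE /= counit1 scale1r.
- by rewrite !linearP /= IHa IHb.
- by rewrite rmorphM slice_counitM IHa IHb.
Qed.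

(** The coradical filtration with indices shifted by one: [corad 0] is zero,
[corad 1] is the line of scalars, and [corad n.+1] consists of the elements of
degree at most n. *)
Fixpoint corad n (h : H) : Prop :=
  if n is n'.+1 then right_in (corad n') (comul h - 1 ⊗ h) else h = 0.

Lemma corad_subspace n : subspace (corad n).
Proof.
elim: n => [|n _]; first by split=> // c x y -> ->; rewrite scaler0 addr0.
split=> [|c x y] /=; first by rewrite linear0 kpure0r subr0; exact: right_in0.
move=> Wx Wy; rewrite linearP kpureDr kpureZr opprD addrACA -scalerBr.
by apply: right_inD => //; exact: right_inZ.
Qed.

Lemma corad0 n : corad n 0.
Proof. exact: (corad_subspace n).1. Qed.

Lemma coradS n h : corad n h -> corad n.+1 h.
Proof.
elim: n h => [|n IHn] h; first by move=> ->; exact: corad0.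
exact: right_in_mono.
Qed.

Lemma corad_le m n h : (m <= n)%N -> corad m h -> corad n h.
Proof.
move=> /subnK <-; elim: (n - m)%N => // d IHd Wh.
by rewrite addSn; apply/coradS/IHd.
Qed.

Lemma right_in_mul (W1 W2 W : H -> Prop) (x y : H2) :
    right_in W1 x -> right_in W2 y -> (forall b b', W1 b -> W2 b' -> W (b * b')) ->
  right_in W (x * y).
Proof.
move=> W1x W2y WM; elim: W1x => {x} [|x x' _ IHx _ IHx'|a b W1b].
- by rewrite mul0r; exact: right_in0.
- by rewrite mulrDl; exact: right_inD.
elim: W2y => {y} [|y y' _ IHy _ IHy'|a' b' W2b'].
- by rewrite mulr0; exact: right_in0.
- by rewrite mulrDr; exact: right_inD.
by rewrite kpureM; apply: right_in_pure; exact: WM.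
Qed.

Lemma comulM_sub (f h : H) : comul (f * h) - 1 ⊗ (f * h) =
  (comul f - 1 ⊗ f) * (1 ⊗ h) + (1 ⊗ f) * (comul h - 1 ⊗ h)
  + (comul f - 1 ⊗ f) * (comul h - 1 ⊗ h).
Proof.
have -> : 1 ⊗ (f * h) = (1 ⊗ f) * (1 ⊗ h) :> H2 by rewrite kpureM mul1r.
rewrite rmorphM /=; move: (comul f) (comul h) => x y.
rewrite -addrA -mulrDl [1 ⊗ f + _]addrC subrK.
by rewrite [RHS]addrC mulrBl mulrBr addrA subrK.
Qed.

(** Degrees are subadditive.  With the shifted indices, n.+1 and m.+1 combine to
(n + m).+1, and a factor in [corad 0] vanishes; hence the predecessor. *)
Lemma coradM n m f h : corad n f -> corad m h -> corad (n + m).-1 (f * h).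
Proof.
elim: {n m}(n + m)%N {-2}n {-2}m (leqnn (n + m)%N) f h => [|N IHN] [|n] [|m] // leN f h.
- by move=> ->; rewrite mul0r => _; exact: corad0.
- by move=> ->; rewrite mul0r => _; exact: corad0.
- by move=> ->; rewrite mul0r => _; exact: corad0.
- by move=> _ ->; rewrite mulr0; exact: corad0.
move=> Wf Wh; rewrite addSn /= addnS /= comulM_sub.
have leN' : (n + m < N)%N by rewrite addSn addnS in leN.
have step1 b b' : corad n b -> b' = h -> corad (n + m) (b * b').
  move=> Wb ->.
  by have := IHN n m.+1; rewrite addnS /=; apply.
have step2 b b' : b = f -> corad m b' -> corad (n + m) (b * b').
  move=> -> Wb'.
  by have := IHN n.+1 m; rewrite addSn /=; apply.
have step3 b b' : corad n b -> corad m b' -> corad (n + m) (b * b').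
  move=> Wb Wb'; apply: (corad_le (leq_pred _)).
  by apply: IHN => //; exact: ltnW.
apply: right_inD; last exact: right_in_mul step3.
apply: right_inD; first by apply: (right_in_mul _ _ step1) => //; exact: right_in_pure.
by apply: (right_in_mul _ _ step2) => //; exact: right_in_pure.
Qed.

Lemma corad_exhaustive h : exists n, corad n h.
Proof.
have corad1 : corad 1 1 by rewrite /= rmorph1 kpure1 subrr; exact: right_in0.
elim/U_ind: h => [x|| c a b [n Wa] [m Wb]|a b [n Wa] [m Wb]].
- exists 2%N => /=; rewrite comul_gen addrK; exact: right_in_pure.
- by exists 1%N.
- exists (maxn n m); apply: (corad_subspace _).2.
    exact: corad_le (leq_maxl _ _) Wa.
  exact: corad_le (leq_maxr _ _) Wb.
- by exists (n + m).-1; exact: coradM.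
Qed.
End Coradical.

(** * Contraction by functionals and convolution powers *)

Section Contraction.
Variables (k : fieldType) (g : lieAlgType k).
Local Notation H := (U g).
Local Notation H2 := (H ⊗ H)%type.
Implicit Types l mu : {linear H -> k^o}.

Definition contract l : H -> H := slice l \o @comul k g.
HB.instance Definition _ l := GRing.Linear.on (contract l).

Lemma contract_slice_sub l h : l 1 = 0 -> contract l h = slice l (comul h - 1 ⊗ h).
Proof. by move=> l1; rewrite linearB /= sliceE l1 scale0r subr0. Qed.

Lemma corad_contract l n h : l 1 = 0 -> corad n.+1 h -> corad n (contract l h).
Proof.
move=> l1 /= Wh; rewrite contract_slice_sub //.
exact: right_in_slice (corad_subspace g n) Wh.
Qed.

Lemma iter_contract0 l n : iter n (contract l) 0 = 0.
Proof. by elim: n => //= n ->; exact: linear0. Qed.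

Lemma iter_contractD l n x y :
  iter n (contract l) (x + y) = iter n (contract l) x + iter n (contract l) y.
Proof. by elim: n => //= n ->; exact: linearD. Qed.

Lemma iter_contractZ l n c x :
  iter n (contract l) (c *: x) = c *: iter n (contract l) x.
Proof. by elim: n => //= n ->; exact: linearZ. Qed.

Lemma iter_contract_eq0 l n m h :
  l 1 = 0 -> (n <= m)%N -> corad n h -> iter m (contract l) h = 0.
Proof.
move=> l1; elim: m n h => [|m IHm] [|n] h // lenm Wh.
- by rewrite Wh iter_contract0.
- by rewrite iterSr; apply: (IHm n) => //; exact: corad_contract.
Qed.

Lemma slice_1pure l (h : H) (x : H2) : slice l ((1 ⊗ h) * x) = h * slice l x.
Proof.
elim/ktens_ind: x => [|x x' IHx IHx'|a b].
- by rewrite mulr0 !linear0 mulr0.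
- by rewrite mulrDr !linearD /= mulrDr IHx IHx'.
- by rewrite kpureM !sliceE mul1r -scalerAr.
Qed.

Lemma slice_pure1 l (h : H) (x : H2) : slice l (x * (1 ⊗ h)) = slice l x * h.
Proof.
elim/ktens_ind: x => [|x x' IHx IHx'|a b].
- by rewrite mul0r !linear0 mul0r.
- by rewrite mulrDl !linearD /= mulrDl IHx IHx'.
- by rewrite kpureM !sliceE mulr1 -scalerAl.
Qed.

(** The contraction is a derivation up to the product of the lower parts of
Delta f and Delta h. *)
Lemma contractM l n m f h : l 1 = 0 -> corad n.+1 f -> corad m.+1 h ->
  exists2 r, corad (n + m).-1 r &
    contract l (f * h) = contract l f * h + f * contract l h + r.
Proof.
move=> l1 Wf Wh.
exists (slice l ((comul f - 1 ⊗ f) * (comul h - 1 ⊗ h))).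
  apply: right_in_slice (corad_subspace g _) _.
  by apply: (right_in_mul Wf Wh) => b b'; exact: coradM.
rewrite contract_slice_sub // comulM_sub !linearD /=.
by rewrite slice_1pure slice_pure1 -!contract_slice_sub.
Qed.

(** Leibniz' formula reduces to its single term of bidegree (n, m): a further
contraction annihilates either factor, and Pascal's rule counts the ways to
reach that term. *)
Lemma iter_contractM l n m f h : l 1 = 0 -> corad n.+1 f -> corad m.+1 h ->
  iter (n + m) (contract l) (f * h) =
    'C(n + m, n)%:R *: (iter n (contract l) f * iter m (contract l) h).
Proof.
move=> l1; elim: {n m}(n + m)%N {-2}n {-2}m (erefl (n + m)%N) f h
  => [|N IHN] n m nmN f h Wf Wh.
  move: nmN Wf Wh => /eqP; rewrite addn_eq0 => /andP[/eqP-> /eqP->] _ _.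
  by rewrite bin0 scale1r.
have [r Wr fhE] := contractM l1 Wf Wh.
rewrite nmN /= in Wr.
rewrite nmN iterSr fhE !iter_contractD (iter_contract_eq0 l1 (leqnn N) Wr) addr0.
have Df := corad_contract l1 Wf; have Dh := corad_contract l1 Wh.
case: n m nmN Wf Wh Df Dh {fhE Wr r} => [|n] [|m] // nmN Wf Wh Df Dh.
- have NE : N = (0 + m)%N by case: nmN.
  by rewrite Df mul0r iter_contract0 add0r NE IHN // !bin0 iterSr.
- have NE : N = (n + 0)%N by case: nmN.
  by rewrite Dh mulr0 iter_contract0 addr0 NE IHN // !addn0 !binn iterSr.
have NE1 : N = (n + m.+1)%N by case: nmN.
have NE2 : N = (n.+1 + m)%N by rewrite NE1 addnS.
rewrite {1}NE1 IHN // NE2 IHN // -NE2 NE1 -!iterSr -scalerDl -natrD -NE1.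
by rewrite binS addnC.
Qed.

(** The n-th convolution power of [l]. *)
Definition cpow l n : H -> k^o := @counit k g \o iter n (contract l).
Lemma cpow_linear l n : linear (cpow l n).
Proof.
by move=> c x y; rewrite /cpow /= iter_contractD iter_contractZ linearP.
Qed.
HB.instance Definition _ l n :=
  GRing.isLinear.Build k H k^o *:%R (cpow l n) (cpow_linear l n).

Lemma cpow_eq0 l n m h : l 1 = 0 -> (n <= m)%N -> corad n h -> cpow l m h = 0.
Proof. by move=> l1 nm Wh; rewrite /cpow /= (iter_contract_eq0 l1 nm Wh) linear0. Qed.

Lemma cpowM l n m f h : l 1 = 0 -> corad n.+1 f -> corad m.+1 h ->
  cpow l (n + m) (f * h) = 'C(n + m, n)%:R * (cpow l n f * cpow l m h).
Proof.
by move=> l1 Wf Wh; rewrite /cpow /= iter_contractM // linearZ /= counitM.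
Qed.

Lemma tfun_swap l mu (t : H2) : tfun mu l (tswap t) = tfun l mu t.
Proof.
elim/ktens_ind: t => [|x y IHx IHy|a b].
- by rewrite !linear0.
- by rewrite !linearD /= IHx IHy.
- by rewrite tswapE !tfunE mulrC.
Qed.

Lemma contract_contract l mu h : contract l (contract mu h) =
  slice (tfun mu l) (tmap (@comul k g) (@idfun H) (comul h)).
Proof.
rewrite -comul_coassoc /contract /=; move: (comul h) => t.
elim/ktens_ind: t => [|x y IHx IHy|a b].
- by rewrite !linear0.
- by rewrite !linearD /= IHx IHy.
rewrite tmapE sliceE linearZ /= linearZ /=; move: (comul b) => t.
elim/ktens_ind: t => [|x y IHx IHy|b' c].
- by rewrite kpure0r !linear0.
- by rewrite kpureDr !linearD /= IHx IHy.
- by rewrite tassocE !sliceE /= tfunE scalerA.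
Qed.

(** The composite of two contractions is the contraction by a convolution
product, which is commutative because Delta is cocommutative. *)
Lemma contractC l mu h : contract l (contract mu h) = contract mu (contract l h).
Proof.
rewrite !contract_contract; move: (comul h) => t.
elim/ktens_ind: t => [|x y IHx IHy|a b].
- by rewrite !linear0.
- by rewrite !linearD /= IHx IHy.
- by rewrite tmapE !sliceE /= -[in RHS]comul_cocomm tfun_swap.
Qed.

Lemma contract_line l mu (t : k) h :
  contract (l \+ t \*: mu) h = contract l h + t *: contract mu h.
Proof.
rewrite /contract /=; elim/ktens_ind: (comul h) => [|x y IHx IHy|a b].
- by rewrite !linear0 addr0.
- by rewrite !linearD /= IHx IHy addrACA.
- by rewrite !sliceE /= scalerDl scalerA.
Qed.

Lemma cpowS l n h : cpow l n.+1 h = cpow l n (contract l h).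
Proof. by rewrite /cpow /= -iterSr. Qed.

(** The convolution power of order n of l + t mu, evaluated at h, as a
polynomial in t (see [horner_line_poly]): its coefficients allow one to
choose t generically. *)
Fixpoint line_poly l mu n h : {poly k} :=
  if n is n'.+1 then
    line_poly l mu n' (contract l h) + 'X * line_poly l mu n' (contract mu h)
  else (@counit k g h)%:P.

Lemma horner_line_poly l mu n h t :
  (line_poly l mu n h).[t] = cpow (l \+ t \*: mu) n h.
Proof.
elim: n h => [|n IHn] h; first by rewrite /= hornerC.
by rewrite /= !hornerE !IHn cpowS contract_line linearD linearZ.
Qed.

Lemma line_poly_coef0 l mu n h : (line_poly l mu n h)`_0 = cpow l n h.
Proof.
elim: n h => [|n IHn] h; first by rewrite /= coefC.
by rewrite /= coefD coefXM /= addr0 IHn cpowS.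
Qed.

Lemma line_poly_coef1 l mu n h :
  (line_poly l mu n.+1 h)`_1 = n.+1%:R * cpow l n (contract mu h).
Proof.
elim: n h => [|n IHn] h; first by rewrite /= coefD coefXM /= !coefC /= add0r mul1r.
rewrite [line_poly _ _ _ _]/= coefD coefXM /= -/(line_poly _ _ n.+1 _) IHn.
rewrite -[_`_0]/((line_poly l mu n.+1 (contract mu h))`_0) line_poly_coef0 -contractC -cpowS.
by rewrite [in RHS]mulrSr mulrDl mul1r.
Qed.

Lemma size_line_poly l mu n h : (size (line_poly l mu n h) <= n.+1)%N.
Proof.
elim: n h => [|n IHn] h /=; first exact: size_polyC_leq1.
rewrite (leq_trans (size_polyD _ _)) // geq_max (leq_trans (IHn _)) //=.
by rewrite mulrC (leq_trans (size_polyMleq _ _)) // size_polyX addn2 /= ltnS.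
Qed.

Lemma line_poly_coefn l mu n h : (line_poly l mu n h)`_n = cpow mu n h.
Proof.
elim: n h => [|n IHn] h; first by rewrite /= coefC.
rewrite /= coefD coefXM /= IHn nth_default ?size_line_poly // add0r.
by rewrite cpowS.
Qed.

Hypothesis char0 : [pchar k] =i pred0.

Lemma natr_eq0_char0 n : (n%:R == 0 :> k) = (n == 0)%N.
Proof. by move: n; exact/pcharf0P. Qed.

Lemma poly_nonroot (p : {poly k}) : p != 0 -> exists t, p.[t] != 0.
Proof.
move=> p0; apply: contrapT => all_root.
pose rs := [seq i%:R : k | i <- iota 0 (size p)].
have: (size rs < size p)%N.
  apply: max_poly_roots => //.
    apply/allP => t _; apply/negPn/negP => pt; by apply: all_root; exists t.
  rewrite map_inj_in_uniq ?iota_uniq // => i j _ _.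
  wlog ij : i j / (i <= j)%N => [WL|].
    by case/orP: (leq_total i j) => ij E; [|apply/esym]; apply: WL.
  move/eqP; rewrite eq_sym -subr_eq0 -natrB // natr_eq0_char0 subn_eq0 => ji.
  by apply/eqP; rewrite eqn_leq ij ji.
by rewrite size_map size_iota ltnn.
Qed.

Lemma corad1 (h : H) : corad 1 h -> h = (counit h : k) *: 1.
Proof.
move=> Wh; have /eqP : comul h - 1 ⊗ h = 0.
  by apply: (right_in_eq0 (F := idfun)) Wh => // u _ ->; exact: kpure0r.
rewrite subr_eq0 => /eqP hE; rewrite -[LHS]counit_comul.
by rewrite -comul_cocomm hE tswapE sliceE.
Qed.

(** For n > 0, some contraction of h by mu has degree exactly n.-1, otherwise every
slice of Delta h - 1 ⊗ h, hence h itself, would have smaller degree.  By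
induction some l detects this contraction.  The polynomial of the line l + t mu
then has the nonzero linear coefficient n l^(n.-1)(mu . h), and any value of t
outside its roots will do.  Characteristic 0 is used for the factor n. *)
Lemma cpow_nonzero n (h : H) : corad n.+1 h -> ~ corad n h ->
  exists2 l : {linear H -> k^o}, l 1 = 0 & cpow l n h != 0.
Proof.
elim: n h => [|n IHn] h Wh nWh.
  exists \0 => //; rewrite /cpow /=; apply/eqP => h0; apply: nWh.
  by rewrite /= (corad1 Wh) h0 scale0r.
have [mu mu1 Wmu] : exists2 mu : {linear H -> k^o}, mu 1 = 0 & ~ corad n (contract mu h).
  apply: contrapT => none; apply: nWh => /=; apply: right_in_of_slices => l.
  (* The counit is subtracted so that the functional vanishes at 1. *)
  pose mu := l \+ (- (l 1 : k)) \*: @counit k g.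
  have mu1 : mu 1 = 0 by rewrite /mu /= counit1 [_ *: _]mulr1 subrr.
  have : corad n (contract mu h) by apply: contrapT => ?; apply: none; exists mu.
  by rewrite contract_line /contract /= counit_comul scaleNr linearB /= sliceE.
have [l l1 lh] := IHn _ (corad_contract mu1 Wh) Wmu.
have [|t] := @poly_nonroot (line_poly l mu n.+1 h).
  apply/eqP => p0; have := line_poly_coef1 l mu n h.
  rewrite p0 coef0 => /esym/eqP; rewrite mulf_eq0 natr_eq0_char0 /=.
  exact/negP.
rewrite horner_line_poly => ne0; exists (l \+ t \*: mu) => //=.
by rewrite l1 mu1 scaler0 addr0.
Qed.

(** If l detects f and mu detects h, then the values of the powers of l + t mu at f
and at h are nonzero polynomials in t: the constant coefficient of the first is
given by l, the coefficient of t^m in the second by mu.  Take t outside the roots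
of their product. *)
Lemma cpow_nonzero2 n m (f h : H) :
    corad n.+1 f -> ~ corad n f -> corad m.+1 h -> ~ corad m h ->
  exists l : {linear H -> k^o}, [/\ l 1 = 0, cpow l n f != 0 & cpow l m h != 0].
Proof.
move=> Wf nWf Wh nWh.
have [l l1 lf] := cpow_nonzero Wf nWf; have [mu mu1 muh] := cpow_nonzero Wh nWh.
have [|t] := @poly_nonroot (line_poly l mu n f * line_poly l mu m h).
  rewrite mulf_neq0 //; apply/eqP => p0.
    by move: lf; rewrite -(line_poly_coef0 l mu) p0 coef0 eqxx.
  by move: muh; rewrite -(line_poly_coefn l mu) p0 coef0 eqxx.
rewrite hornerM !horner_line_poly mulf_eq0 negb_or => /andP[tf th].
by exists (l \+ t \*: mu); split=> //=; rewrite l1 mu1 scaler0 addr0.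
Qed.

Lemma corad_degree (s : seq H) : (exists2 h, h \in s & h != 0) ->
  exists n, (forall h, h \in s -> corad n.+1 h) /\ exists2 h, h \in s & ~ corad n h.
Proof.
move=> [h0 h0s h00].
have ex_n : exists n, `[< forall h, h \in s -> corad n h >].
  have [f fP] := choice (@corad_exhaustive k g).
  exists (\max_(h <- s) f h)%N; apply/asboolP => h hs.
  exact: corad_le (leq_bigmax_seq _ hs _) (fP h).
case: (ex_minnP ex_n) => -[|n] /asboolP Wn n_min.
  by have /= h0E := Wn _ h0s; rewrite h0E eqxx in h00.
exists n; split=> //; apply: contrapT => none.
have /n_min : `[< forall h, h \in s -> corad n h >].
  by apply/asboolP => h hs; apply: contrapT => nW; apply: none; exists h.
by rewrite ltnn.
Qed.

End Contraction.

(** * Equations in H ⊗ H ⊗ H *)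

Section Equations.
Variables (k : fieldType) (g : lieAlgType k).
Local Notation H := (U g).
Local Notation H2 := (H ⊗ H)%type.
Local Notation H3 := (H ⊗ H ⊗ H)%type.

Lemma perm12E (a b c : H) : perm12 g ((a ⊗ b) ⊗ c) = (b ⊗ a) ⊗ c.
Proof. by rewrite /perm12 /= tmapE /= tswapE. Qed.

Lemma perm12D : {morph perm12 g : x y / x + y}.
Proof. by move=> x y; exact: (raddfD (perm12 g)). Qed.

Lemma comul_idE (a b : H) : comul_id g (a ⊗ b) = comul a ⊗ b.
Proof. by rewrite /comul_id /= tmapE. Qed.

Lemma comul_idD : {morph comul_id g : x y / x + y}.
Proof. by move=> x y; exact: (raddfD (comul_id g)). Qed.

Lemma id_comulE (a b : H) : id_comul g (a ⊗ b) = tassoc (a ⊗ comul b).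
Proof. by rewrite /id_comul /= tmapE. Qed.

Lemma id_comulD : {morph id_comul g : x y / x + y}.
Proof. by move=> x y; exact: (raddfD (id_comul g)). Qed.

(** The term of (α ⊗ 1) (Δ ⊗ id)(α') contributed by a ⊗ c in α and by a' ⊗ c' in
α', where t stands for Δ(a'). *)
Definition comul_term (a c : H) (t : H2) (c' : H) : H3 := ((a ⊗ c) ⊗ 1) * (t ⊗ c').

Lemma comul_termE a c y z c' :
  comul_term a c (y ⊗ z) c' = ((a * y) ⊗ (c * z)) ⊗ c'.
Proof. by rewrite /comul_term kpureM kpureM mul1r. Qed.

Lemma comul_termD a c c' : {morph comul_term a c ^~ c' : t t' / t + t'}.
Proof. by move=> t t'; rewrite /comul_term kpureDl mulrDr. Qed.

(** The term of (1 ⊗ α) (id ⊗ Δ)(α') contributed by a ⊗ c in α and by a' ⊗ c' in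
α', where t stands for Δ(c'). *)
Definition assoc_term (a c a' : H) (t : H2) : H3 :=
  tassoc (1 ⊗ (a ⊗ c)) * tassoc (a' ⊗ t).

Lemma assoc_termE a c a' y z :
  assoc_term a c a' (y ⊗ z) = (a' ⊗ (a * y)) ⊗ (c * z).
Proof. by rewrite /assoc_term tassocE tassocE kpureM kpureM mul1r. Qed.

Lemma assoc_termD a c a' : {morph assoc_term a c a' : t t' / t + t'}.
Proof. by move=> t t'; rewrite /assoc_term kpureDr linearD /= mulrDr. Qed.

Lemma morph_sum (V W : zmodType) (F : V -> W) (I : Type) (r : seq I) (f : I -> V) :
  {morph F : x y / x + y} -> F (\sum_(i <- r) f i) = \sum_(i <- r) F (f i).
Proof. by move=> FD; apply: big_morph => //; exact: zmod_morphism0. Qed.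

Lemma morph_sub (V W : zmodType) (F : V -> W) x y :
  {morph F : x y / x + y} -> F (x - y) = F x - F y.
Proof. by move=> FD; apply/eqP; rewrite eq_sym subr_eq -FD subrK. Qed.

Lemma comul_sumE r (u v : 'I_r -> H) s (u' v' : 'I_s -> H) :
  (tensor_sum u v ⊗ 1) * comul_id g (tensor_sum u' v') =
  \sum_i \sum_j comul_term (u i) (v i) (comul (u' j)) (v' j).
Proof.
rewrite /tensor_sum kpure_suml (morph_sum _ _ comul_idD) mulr_suml.
apply: eq_bigr => i _; rewrite mulr_sumr; apply: eq_bigr => j _.
by congr (_ * _); exact: comul_idE.
Qed.

Lemma assoc_sumE r (u v : 'I_r -> H) s (u' v' : 'I_s -> H) :
  tassoc (1 ⊗ tensor_sum u v) * id_comul g (tensor_sum u' v') =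
  \sum_i \sum_j assoc_term (u i) (v i) (u' j) (comul (v' j)).
Proof.
rewrite /tensor_sum kpure_sumr (morph_sum _ _ id_comulD).
rewrite (morph_sum _ _ (linearD (@tassoc k H H H))) mulr_suml.
apply: eq_bigr => i _; rewrite mulr_sumr; apply: eq_bigr => j _.
by congr (_ * _); exact: id_comulE.
Qed.

(** Additivity and the values on pure tensors are all that the degree arguments
use of a functional on H ⊗ H ⊗ H. *)
Lemma ev3_exists (l m n : {linear H -> k^o}) : exists F : H3 -> k,
  {morph F : x y / x + y} /\ forall a b c, F ((a ⊗ b) ⊗ c) = l a * m b * n c.
Proof.
exists (tfun (tfun l m) n); split=> [x y|a b c]; first exact: linearD.
by rewrite tfunE /= tfunE.
Qed.

Lemma sum_delta r s (w : 'I_r -> 'I_s -> k) i0 j0 :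
  \sum_i \sum_j w i j * (i0 == i)%:R * (j0 == j)%:R = w i0 j0.
Proof.
rewrite (bigD1 i0) //= (bigD1 j0) //= !eqxx !mulr1 big1 => [|j jj0]; last first.
  by rewrite [j0 == j]eq_sym (negPf jj0) mulr0.
rewrite addr0 big1 ?addr0 // => i ii0; rewrite big1 // => j _.
by rewrite [i0 == i]eq_sym (negPf ii0) mulr0 mul0r.
Qed.

(** A map that ignores lower-degree right factors sees only the term 1 ⊗ h of
Delta h. *)
Lemma comul_top_right (Z : zmodType) (F : H2 -> Z) n (h : H) :
    {morph F : x y / x + y} -> (forall y z, corad n z -> F (y ⊗ z) = 0) ->
  corad n.+1 h -> F (comul h) = F (1 ⊗ h).
Proof.
move=> FD F0 Wh; rewrite -[comul h](subrK (1 ⊗ h)) FD.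
by rewrite (right_in_eq0 FD F0 Wh) add0r.
Qed.

Lemma comul_top_left (Z : zmodType) (F : H2 -> Z) n (h : H) :
    {morph F : x y / x + y} -> (forall y z, corad n y -> F (y ⊗ z) = 0) ->
  corad n.+1 h -> F (comul h) = F (h ⊗ 1).
Proof.
move=> FD F0 Wh; rewrite -comul_cocomm -(tswapE 1 h).
apply: (comul_top_right (F := F \o @tswap k H H)) Wh => [x y|y z Wz] /=.
  by rewrite linearD FD.
by rewrite tswapE F0.
Qed.

Lemma dual_family_neq0 (V : lmodType k) r (v : 'I_r -> V) psi i :
  dual_family v psi -> v i != 0.
Proof.
move=> vpsi; apply/eqP => vi0; have := vpsi i i.
by rewrite vi0 linear0 eqxx => /esym/eqP; rewrite oner_eq0.
Qed.

Lemma dual_family_degree r (u : 'I_r.+1 -> H) phi : dual_family u phi ->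
  exists n, (forall i, corad n.+1 (u i)) /\ exists i, ~ corad n (u i).
Proof.
move=> uphi.
have [|n [Wu [_ /codomP[i ->] nWu]]] := @corad_degree k g (codom u).
  by exists (u ord0); [exact: codom_f|exact: dual_family_neq0 uphi].
by exists n; split=> [j|]; [apply: Wu; exact: codom_f|exists i].
Qed.

Hypothesis char0 : [pchar k] =i pred0.

Lemma bin_neq0 n m : 'C(n + m, n)%:R != 0 :> k.
Proof. by rewrite natr_eq0_char0 // -lt0n bin_gt0 leq_addr. Qed.

(** Let n and m be the degrees of the two families in a normal form of b, and let
m > 0.  A functional on the first factor given by a convolution power of order
n + m kills the left side, whose first factors have degree at most n; on the
right side it leaves the product of the n-th power at a left entry by the m-th
power at a right entry, which can be chosen nonzero. *)
Lemma invariant_square_pure (b : H2) :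
    tassoc (1 ⊗ b) * id_comul g b = perm12 g (tassoc (1 ⊗ b) * id_comul g b) ->
  exists h, b = h ⊗ 1.
Proof.
have [r [u [v [phi [psi [-> uphi vpsi]]]]]] := tensor_normal_form b.
case: r u v phi psi uphi vpsi => [|r] u v phi psi uphi vpsi.
  by exists 0; rewrite /tensor_sum big_ord0 [RHS](zmod_morphism0 (fun x y => kpureDl x y 1)).
have [n [Wu [i0 nWu]]] := dual_family_degree uphi.
have [m [Wv [j0 nWv]]] := dual_family_degree vpsi.
case: m Wv nWv => [|m] Wv nWv.
  exists (\sum_i (counit (v i) : k) *: u i); rewrite kpure_suml.
  by apply: eq_bigr => i _; rewrite {1}(corad1 (Wv i)) kpureZr kpureZl.
have [l [l1 lu lv]] := cpow_nonzero2 char0 (Wu i0) nWu (Wv j0) nWv.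
(* The dual functionals select the entry j0 of degree exactly m, which the
   permutation moves into the first factor, and the entry i0 of degree n. *)
have [F [FD FE]] := ev3_exists (cpow l (n + m.+1)) (phi j0) (psi i0).
have F0 : F 0 = 0 := zmod_morphism0 FD.
have F'D : {morph F \o perm12 g : x y / x + y}.
  by move=> x y /=; rewrite perm12D FD.
have termE i j : F (assoc_term (u i) (v i) (u j) (comul (v j))) = 0.
  elim/ktens_ind: (comul (v j)) => [|x y IHx IHy|y z].
  - by rewrite (zmod_morphism0 (assoc_termD _ _ _)).
  - by rewrite assoc_termD FD IHx IHy addr0.
  rewrite assoc_termE FE /= (cpow_eq0 (n := n.+1)) ?mul0r //.
  by rewrite addnS ltnS leq_addr.
have ptermE i j : F (perm12 g (assoc_term (u i) (v i) (u j) (comul (v j))))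
    = cpow l (n + m.+1) (u i * v j) * (i0 == i)%:R * (j0 == j)%:R.
  rewrite (comul_top_left (n := m.+1)
    (F := fun t => F (perm12 g (assoc_term (u i) (v i) (u j) t)))) //.
  - by rewrite assoc_termE perm12E FE mulr1 uphi vpsi mulrAC.
  - by move=> x y; rewrite assoc_termD perm12D FD.
  move=> y z Wy; rewrite assoc_termE perm12E FE /= (cpow_eq0 (n := n + m.+1)) ?mul0r //.
  exact: (coradM (Wu i) Wy).
rewrite assoc_sumE => /(congr1 F).
rewrite (morph_sum _ _ FD) big1 => [|i _]; last first.
  by rewrite (morph_sum _ _ FD) big1.
have -> : F (perm12 g (\sum_i \sum_j assoc_term (u i) (v i) (u j) (comul (v j))))
    = cpow l (n + m.+1) (u i0 * v j0).
  rewrite [LHS](morph_sum _ _ F'D) -(sum_delta (fun i j => cpow l (n + m.+1) (u i * v j))).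
  by apply: eq_bigr => i _; rewrite (morph_sum _ _ F'D); apply: eq_bigr => j _; exact: ptermE.
rewrite (cpowM l1 (Wu i0) (Wv j0)) => /esym/eqP.
by rewrite !mulf_eq0 (negPf (bin_neq0 _ _)) (negPf lu) (negPf lv).
Qed.

Lemma tensor_sum1 (x y : H) : x ⊗ y = tensor_sum (fun _ : 'I_1 => x) (fun _ => y).
Proof. by rewrite /tensor_sum big_ord1. Qed.

(** Let n be the degree of a in its first factor.  A convolution power of order
2n on that factor retains on the left the square of the n-th power at an entry;
on the right, the contributions of the two terms are equal.  When n = 0 the power
is the counit and the same computation applies. *)
Lemma mixed_coefficient_eq0 (x : H) (a : H2) :
    (a ⊗ 1) * comul_id g a =
    perm12 g (((x ⊗ 1) ⊗ 1) * comul_id g a - tassoc (1 ⊗ a) * id_comul g (x ⊗ 1)) ->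
  a = 0.
Proof.
have [r [u [v [phi [psi [-> uphi vpsi]]]]]] := tensor_normal_form a.
case: r u v phi psi uphi vpsi => [|r] u v phi psi uphi vpsi.
  by rewrite /tensor_sum big_ord0.
have [n [Wu [i0 nWu]]] := dual_family_degree uphi.
have [l l1 lu] := cpow_nonzero char0 (Wu i0) nWu.
have [F [FD FE]] := ev3_exists (cpow l (n + n)) (psi i0) (psi i0).
have F'D : {morph F \o perm12 g : x y / x + y}.
  by move=> y z /=; rewrite perm12D FD.
have squareE i j : F (comul_term (u i) (v i) (comul (u j)) (v j))
    = cpow l (n + n) (u i * u j) * (i0 == i)%:R * (i0 == j)%:R.
  rewrite (comul_top_left (n := n)
    (F := fun t => F (comul_term (u i) (v i) t (v j)))) //.
  - by rewrite comul_termE FE mulr1 !vpsi.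
  - by move=> y z; rewrite comul_termD FD.
  move=> y z Wy; rewrite comul_termE FE /= (cpow_eq0 (n := n + n)) ?mul0r //.
  exact: (coradM (Wu i) Wy).
have swapE j : F (perm12 g (comul_term x 1 (comul (u j)) (v j)))
    = cpow l (n + n) (u j) * psi i0 x * psi i0 (v j).
  rewrite (comul_top_right (n := n)
    (F := fun t => F (perm12 g (comul_term x 1 t (v j))))) //.
  - by rewrite comul_termE perm12E FE mulr1 mul1r.
  - by move=> y z; rewrite comul_termD perm12D FD.
  move=> y z Wz; rewrite comul_termE perm12E FE /= (cpow_eq0 (n := n)) ?mul0r ?mul1r //.
  exact: leq_addr.
have assocE i : F (perm12 g (assoc_term (u i) (v i) x (comul 1)))
    = cpow l (n + n) (u i) * psi i0 x * psi i0 (v i).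
  by rewrite rmorph1 kpure1 assoc_termE perm12E FE !mulr1.
rewrite (tensor_sum1 x 1) !comul_sumE assoc_sumE => /(congr1 F).
rewrite big_ord1 (_ : F (perm12 g _) = 0).
  rewrite (morph_sum _ _ FD).
  under eq_bigr => i _ do
    (rewrite (morph_sum _ _ FD); under eq_bigr => j _ do rewrite squareE).
  rewrite (sum_delta (fun i j => cpow l (n + n) (u i * u j))).
  rewrite (cpowM l1 (Wu i0) (Wu i0)) => /eqP.
  by rewrite !mulf_eq0 (negPf (bin_neq0 _ _)) (negPf lu).
rewrite -sumrB [LHS](morph_sum _ _ F'D) big1 // => j _ /=.
by rewrite big_ord1 [LHS](morph_sub _ _ F'D) /= swapE assocE subrr.
Qed.

(** If y has degree n, a power of order n on the second factor of Delta y retains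
only 1 ⊗ y, and turns the equation into a nonzero multiple of x = 0. *)
Lemma pure_comul_eq0 (x y : H) : ((x ⊗ 1) ⊗ 1) * comul_id g (y ⊗ 1) = 0 ->
  x = 0 \/ y = 0.
Proof.
rewrite comul_idE kpureM mulr1 => xy0.
have [-> |y0] := eqVneq y 0; [by right|left].
have {}xy0 : (x ⊗ 1) * comul y = 0.
  have := congr1 (slice (@counit k g) \o @tswap k _ _) xy0.
  by rewrite /= tswapE sliceE /= counit1 scale1r !linear0.
have [|n [Wy [z zy nWy]]] := @corad_degree k g [:: y].
  by exists y => //; exact: mem_head.
move: zy nWy; rewrite mem_seq1 => /eqP-> nWy.
have {}Wy := Wy _ (mem_head _ _).
have [l l1 ly] := cpow_nonzero char0 Wy nWy.
pose G (t : H2) := slice (cpow l n) (tswap ((x ⊗ 1) * t)).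
have GE a b : G (a ⊗ b) = (cpow l n b : k) *: (x * a).
  by rewrite /G kpureM mul1r tswapE sliceE.
have : G (comul y) = G (1 ⊗ y).
  apply: (comul_top_right (n := n)) Wy.
    by move=> a b; rewrite /G mulrDr !linearD.
  by move=> a b Wb; rewrite GE (cpow_eq0 (n := n)) ?scale0r.
rewrite GE {1}/G xy0 !linear0 mulr1 => /esym/eqP.
by rewrite scaler_eq0 (negPf ly) => /eqP.
Qed.
End Equations.

(** * Coefficients with respect to a basis *)

Section BaseChangeCoef.
Variables (R S : pzRingType) (phi : {rmorphism R -> S}) (N : lmodType R).
Variable c : {linear N -> R^o}.

(** The coordinate [c] extended to S ⊗_R N by S-linearity. *)
Definition bcoef : base_change phi N -> S := blift (fun s n => s * phi (c n)).

Lemma bcoef_balanced : balanced (morphism_bimodule phi) (fun s n => s * phi (c n) : S).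
Proof.
split=> [s s' n|s n n'|s r n]; first exact: mulrDl.
  by rewrite linearD rmorphD mulrDr.
by rewrite linearZ rmorphM mulrA.
Qed.

Lemma bcoefE s n : bcoef (bpure phi s n) = s * phi (c n).
Proof. exact: tlift_pure bcoef_balanced _ _. Qed.

Lemma bcoefD : {morph bcoef : u v / u + v}.
Proof. exact: tliftD bcoef_balanced. Qed.

Lemma bcoefZ s u : bcoef (s *: u) = s * bcoef u.
Proof.
elim/tens_ind: u => [|u v IHu IHv|t n].
- by rewrite scaler0 (zmod_morphism0 bcoefD) mulr0.
- by rewrite scalerDr !bcoefD IHu IHv mulrDr.
rewrite -[tpure _ t n]/(bpure phi t n) [s *: _]tpureZ.
by rewrite -[tpure _ _ n]/(bpure phi (s * t) n) !bcoefE mulrA.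
Qed.

Lemma bpureDl s s' (n : N) : bpure phi (s + s') n = bpure phi s n + bpure phi s' n.
Proof. exact: tpureDl. Qed.

Lemma bpure0l (n : N) : bpure phi 0 n = 0.
Proof. exact: zmod_morphism0 (fun s s' => bpureDl s s' n). Qed.

Lemma bpureZ s t (n : N) : s *: bpure phi t n = bpure phi (s * t) n.
Proof. exact: tpureZ. Qed.
End BaseChangeCoef.

Lemma bcoef_bmap (R S S' : pzRingType) (phi : {rmorphism R -> S})
    (phi' : {rmorphism R -> S'}) (N : lmodType R) (c : {linear N -> R^o})
    (sigma : {rmorphism S -> S'}) : (forall r, sigma (phi r) = phi' r) ->
  forall u, bcoef c (bmap phi' sigma u : base_change phi' N) =
    sigma (bcoef (phi := phi) c u).
Proof.
move=> sphi; elim/tens_ind=> [|u v IHu IHv|s n].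
- by rewrite !(zmod_morphism0 (bmapD sphi), zmod_morphism0 (@bcoefD _ _ _ _ c), rmorph0).
- by rewrite (bmapD sphi) !bcoefD IHu IHv rmorphD.
rewrite -[tpure _ s n]/(bpure phi s n) (bmapE sphi) !bcoefE.
by rewrite rmorphM sphi.
Qed.

Section Coordinates.
Variables (k : fieldType) (g : lieAlgType k) (P : lmodType (U g)).
Local Notation H := (U g).

(** The two coordinate forms of a basis, kept symmetric in e1 and e2 so that each
consequence of the pre-Lie identity is proved once and transported by
[coordinates_swap]. *)
Definition coordinates (e1 e2 : P) (c1 c2 : {linear P -> H^o}) :=
  [/\ c1 e1 = 1 /\ c1 e2 = 0, c2 e1 = 0 /\ c2 e2 = 1
    & forall x, x = (c1 x : H) *: e1 + (c2 x : H) *: e2].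

Lemma coordinates_swap e1 e2 c1 c2 :
  coordinates e1 e2 c1 c2 -> coordinates e2 e1 c2 c1.
Proof. by move=> [[? ?] [? ?] E]; split=> // x; rewrite addrC; exact: E. Qed.

Lemma coordinates_exist (e1 e2 : P) :
    (forall x : P, exists! c : H * H, x = c.1 *: e1 + c.2 *: e2) ->
  exists c1 c2, coordinates e1 e2 c1 c2.
Proof.
move=> basis.
have [|c cE] := @choice P (H * H)%type (fun x c => x = c.1 *: e1 + c.2 *: e2).
  by move=> x; have [c [cx _]] := basis x; exists c.
have c_unique x a b : x = a *: e1 + b *: e2 -> c x = (a, b).
  move=> xE; have [d [_ d_uniq]] := basis x.
  by rewrite -(d_uniq (c x) (cE x)) (d_uniq (a, b) xE).
have c_lin h x y : c (h *: x + y) = (h * (c x).1 + (c y).1, h * (c x).2 + (c y).2).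
  apply: c_unique; rewrite [in LHS](cE x) [in LHS](cE y) scalerDr !scalerA.
  by rewrite !scalerDl addrACA.
have lin1 : linear ((fun x => (c x).1) : P -> H^o) by move=> h x y; rewrite c_lin.
have lin2 : linear ((fun x => (c x).2) : P -> H^o) by move=> h x y; rewrite c_lin.
pose m1 := GRing.isLinear.Build H P H^o *:%R _ lin1.
pose m2 := GRing.isLinear.Build H P H^o *:%R _ lin2.
pose c1 : {linear P -> H^o} := HB.pack (fun x => (c x).1) m1.
pose c2 : {linear P -> H^o} := HB.pack (fun x => (c x).2) m2.
have ce1 : c e1 = (1, 0) by apply: c_unique; rewrite scale1r scale0r addr0.
have ce2 : c e2 = (0, 1) by apply: c_unique; rewrite scale1r scale0r add0r.
exists c1, c2; split; rewrite /= ?ce1 ?ce2 //.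
Qed.

Lemma tens2_decomposition e1 e2 c1 c2 : coordinates e1 e2 c1 c2 ->
  forall u : tens2 P, u = bcoef c1 u ⊗H e1 + bcoef c2 u ⊗H e2.
Proof.
move=> [_ _ xE]; elim/tens_ind=> [|u v IHu IHv|s x].
- by rewrite !(zmod_morphism0 (@bcoefD _ _ _ _ _)) !bpure0l addr0.
- by rewrite !bcoefD !bpureDl addrACA -IHu -IHv.
rewrite -[tpure _ s x]/(s ⊗H x) !bcoefE {1}(xE x) [LHS]tpureDr.
by congr (_ + _); rewrite [RHS]tpureM.
Qed.
End Coordinates.

(** * The associator of a pseudoproduct *)

Section Associator.
Variables (k : fieldType) (g : lieAlgType k) (P : lmodType (U g)).
Variable p : pseudoproduct P.
Local Notation H := (U g).
Local Notation H2 := (H ⊗ H)%type.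
Local Notation H3 := (H ⊗ H ⊗ H)%type.
Implicit Types (x y z : P) (u v : tens2 P) (a b h : H).

Local Notation bl := (bmap (comul3 g) (comul_id g)).
Local Notation br := (bmap (comul3 g) (id_comul g)).
Local Notation bp := (bmap (comul3 g) (perm12 g)).

Lemma blD : {morph bl : u v / (u + v : tens2 P) >-> (u + v : tens3 P)}.
Proof. exact: bmapD (@comul_id_comul2 k g). Qed.
Lemma brD : {morph br : u v / (u + v : tens2 P) >-> (u + v : tens3 P)}.
Proof. exact: bmapD (@id_comul_comul2 k g). Qed.
Lemma bpD : {morph bp : u v / (u + v : tens3 P) >-> (u + v : tens3 P)}.
Proof. exact: bmapD (@perm12_comul3 k g). Qed.

Lemma pprod_l0 z : pprod_l p 0 z = 0.
Proof. exact: zmod_morphism0 (fun u v => pprod_lD p u v z). Qed.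
Lemma pprod_r0 x : pprod_r p x 0 = 0.
Proof. exact: zmod_morphism0 (pprod_rD p x). Qed.

Lemma pprod_lDr u z z' : pprod_l p u (z + z') = pprod_l p u z + pprod_l p u z'.
Proof.
elim/tens_ind: u => [|u v IHu IHv|s x].
- by rewrite !pprod_l0 addr0.
- by rewrite !pprod_lD IHu IHv addrACA.
by rewrite -[tpure _ s x]/(s ⊗H x) !pprod_lE pprodDr blD scalerDr.
Qed.

Lemma pprod_rDl x x' v : pprod_r p (x + x') v = pprod_r p x v + pprod_r p x' v.
Proof.
elim/tens_ind: v => [|u v IHu IHv|s y].
- by rewrite !pprod_r0 addr0.
- by rewrite !pprod_rD IHu IHv addrACA.
by rewrite -[tpure _ s y]/(s ⊗H y) !pprod_rE pprodDl brD scalerDr.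
Qed.

Lemma pprod_lZ (s : H2) u z : pprod_l p (s *: u) z = (s ⊗ (1 : H)) *: pprod_l p u z.
Proof.
elim/tens_ind: u => [|u v IHu IHv|t x].
- by rewrite scaler0 !pprod_l0 scaler0.
- by rewrite scalerDr !pprod_lD IHu IHv scalerDr.
rewrite -[tpure _ t x]/(t ⊗H x) bpureZ !pprod_lE scalerA kpureM mulr1 //.
Qed.

Lemma pprod_lZr u h z : pprod_l p u (h *: z) = ((1 : H2) ⊗ h) *: pprod_l p u z.
Proof.
elim/tens_ind: u => [|u v IHu IHv|t x].
- by rewrite !pprod_l0 scaler0.
- by rewrite !pprod_lD IHu IHv scalerDr.
rewrite -[tpure _ t x]/(t ⊗H x) !pprod_lE pprodHr (bmapZ (@comul_id_comul2 k g)).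
rewrite !scalerA comul_idE rmorph1 !kpureM !mulr1 !mul1r //.
Qed.

Lemma pprod_rZ (s : H2) x v :
  pprod_r p x (s *: v) = tassoc ((1 : H) ⊗ s) *: pprod_r p x v.
Proof.
elim/tens_ind: v => [|u v IHu IHv|t y].
- by rewrite scaler0 !pprod_r0 scaler0.
- by rewrite scalerDr !pprod_rD IHu IHv scalerDr.
rewrite -[tpure _ t y]/(t ⊗H y) bpureZ !pprod_rE scalerA -rmorphM kpureM mulr1 //.
Qed.

Lemma pprod_rZl h x v : pprod_r p (h *: x) v = ((h ⊗ 1) ⊗ (1 : H)) *: pprod_r p x v.
Proof.
elim/tens_ind: v => [|u v IHu IHv|t y].
- by rewrite !pprod_r0 scaler0.
- by rewrite !pprod_rD IHu IHv scalerDr.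
rewrite -[tpure _ t y]/(t ⊗H y) !pprod_rE pprodHl (bmapZ (@id_comul_comul2 k g)).
rewrite !scalerA id_comulE rmorph1 -tassocE -kpure1 -!rmorphM kpureM kpureM.
by rewrite !mulr1 !mul1r.
Qed.

Definition associator x y z : tens3 P :=
  pprod_l p (p x y) z - pprod_r p x (p y z).

Lemma associatorDl x x' y z :
  associator (x + x') y z = associator x y z + associator x' y z.
Proof. by rewrite /associator pprodDl pprod_lD pprod_rDl opprD addrACA. Qed.
Lemma associatorDm x y y' z :
  associator x (y + y') z = associator x y z + associator x y' z.
Proof.
by rewrite /associator pprodDr pprod_lD pprodDl pprod_rD opprD addrACA.
Qed.
Lemma associatorDr x y z z' :
  associator x y (z + z') = associator x y z + associator x y z'.
Proof. by rewrite /associator pprod_lDr pprodDr pprod_rD opprD addrACA. Qed.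

Lemma associatorZ a b h x y z :
  associator (a *: x) (b *: y) (h *: z) = ((a ⊗ b) ⊗ h) *: associator x y z.
Proof.
rewrite /associator !pprodH pprod_lZ pprod_lZr pprod_rZ pprod_rZl !scalerA scalerBr.
congr (_ - _); congr (_ *: _).
  by rewrite kpureM mulr1 mul1r.
by rewrite -!tassocE -rmorphM kpureM mul1r -kpure1 mulr1.
Qed.

Definition symmetric_at x y z := associator x y z = bp (associator y x z).

Lemma symmetric_atZ a b h x y z :
  symmetric_at x y z -> symmetric_at (a *: x) (b *: y) (h *: z).
Proof.
rewrite /symmetric_at !associatorZ (bmapZ (@perm12_comul3 k g)) => ->.
by rewrite perm12E.
Qed.

(** The identity is stable under scaling each argument, because the permutation
acts on the three scalars as on the arguments, and under sums. *)
Lemma left_preLie_on_basis e1 e2 c1 c2 : coordinates e1 e2 c1 c2 ->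
    (forall x y z, x \in [:: e1; e2] -> y \in [:: e1; e2] -> z \in [:: e1; e2] ->
      symmetric_at x y z) ->
  left_preLie p.
Proof.
move=> [_ _ xE] sym.
have symDl x x' y z : symmetric_at x y z -> symmetric_at x' y z ->
    symmetric_at (x + x') y z.
  by move=> s1 s2; rewrite /symmetric_at associatorDl associatorDm [RHS]bpD s1 s2.
have symDm x y y' z : symmetric_at x y z -> symmetric_at x y' z ->
    symmetric_at x (y + y') z.
  by move=> s1 s2; rewrite /symmetric_at associatorDl associatorDm [RHS]bpD s1 s2.
have symDr x y z z' : symmetric_at x y z -> symmetric_at x y z' ->
    symmetric_at x y (z + z').
  by move=> s1 s2; rewrite /symmetric_at !associatorDr [RHS]bpD s1 s2.
have in1 : e1 \in [:: e1; e2] by rewrite mem_head.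
have in2 : e2 \in [:: e1; e2] by rewrite inE mem_head orbT.
move=> x y z; rewrite -/(associator _ _ _) -/(associator _ _ _) -/(symmetric_at _ _ _).
rewrite (xE x) (xE y) (xE z).
by apply: symDl; apply: symDm; apply: symDr; apply: symmetric_atZ; apply: sym.
Qed.

(** The only associator with a nonzero term is that of (e2, e2, e1), equal to
- (x ⊗ x ⊗ 1) ⊗_H e1, which is symmetric. *)
Lemma left_preLie_right_type e1 e2 c1 c2 (x : H) : coordinates e1 e2 c1 c2 ->
    p e1 e1 = 0 -> p e2 e2 = 0 -> p e1 e2 = 0 -> p e2 e1 = x ⊗ 1 ⊗H e1 ->
  left_preLie p.
Proof.
move=> coords p11 p22 p12 p21; apply: (left_preLie_on_basis coords).
have bl0 := zmod_morphism0 blD; have br0 := zmod_morphism0 brD.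
have bp0 := zmod_morphism0 bpD.
pose E := (p11, p22, p12, pprod_l0, pprod_r0, subr0, bp0).
move=> a b c; rewrite !inE => /orP[]/eqP-> /orP[]/eqP-> /orP[]/eqP->;
  rewrite /symmetric_at /associator ?E //.
all: rewrite ?p21 ?pprod_lE ?pprod_rE ?p11 ?p12 ?bl0 ?br0 ?scaler0 ?subr0 ?bp0 //.
rewrite p21 (bmapE (@id_comul_comul2 k g)) bpureZ.
have -> : tassoc (1 ⊗ (x ⊗ (1 : H))) * id_comul g (x ⊗ 1) = (x ⊗ x) ⊗ 1.
  rewrite id_comulE rmorph1 (@kpure1 k H H) !tassocE kpureM kpureM.
  by rewrite !mul1r !mulr1.
by rewrite [RHS](morph_sub _ _ bpD) bp0 (bmapE (@perm12_comul3 k g)) perm12E.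
Qed.

Section Coefficients.
Variable c : {linear P -> H^o}.
Local Notation coef2 := (bcoef (phi := comul2 g) c).
Local Notation coef3 := (bcoef (phi := comul3 g) c).

Lemma coef_pprod_l (a : H2) x z :
  coef3 (pprod_l p (a ⊗H x) z) = (a ⊗ 1) * comul_id g (coef2 (p x z)).
Proof. by rewrite pprod_lE bcoefZ (bcoef_bmap _ (@comul_id_comul2 k g)). Qed.

Lemma coef_pprod_r (a : H2) x y :
  coef3 (pprod_r p x (a ⊗H y)) = tassoc (1 ⊗ a) * id_comul g (coef2 (p x y)).
Proof. by rewrite pprod_rE bcoefZ (bcoef_bmap _ (@id_comul_comul2 k g)). Qed.

Lemma coef_perm12 (u : tens3 P) : coef3 (bp u) = perm12 g (coef3 u).
Proof. exact: bcoef_bmap (@perm12_comul3 k g) u. Qed.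
End Coefficients.

Section BasisExpansion.
Variables (e1 e2 : P) (c1 c2 : {linear P -> H^o}).
Hypothesis coords : coordinates e1 e2 c1 c2.

Lemma coef_pprod_l_basis (c : {linear P -> H^o}) (u : tens2 P) z : p e2 z = 0 ->
  bcoef c (pprod_l p u z) = (bcoef c1 u ⊗ 1) * comul_id g (bcoef c (p e1 z)).
Proof.
move=> p2z; rewrite {1}(tens2_decomposition coords u) pprod_lD bcoefD !coef_pprod_l p2z.
by rewrite (zmod_morphism0 (@bcoefD _ _ _ _ c)) (zmod_morphism0 (@comul_idD k g)) mulr0 addr0.
Qed.

Lemma coef_pprod_r_basis (c : {linear P -> H^o}) x (u : tens2 P) : p x e2 = 0 ->
  bcoef c (pprod_r p x u) = tassoc (1 ⊗ bcoef c1 u) * id_comul g (bcoef c (p x e1)).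
Proof.
move=> px2; rewrite {1}(tens2_decomposition coords u) pprod_rD bcoefD !coef_pprod_r px2.
by rewrite (zmod_morphism0 (@bcoefD _ _ _ _ c)) (zmod_morphism0 (@id_comulD k g)) mulr0 addr0.
Qed.
End BasisExpansion.

Section NecessaryConditions.
Variables (e1 e2 : P) (c1 c2 : {linear P -> H^o}).
Hypothesis coords : coordinates e1 e2 c1 c2.
Hypotheses (p11 : p e1 e1 = 0) (p22 : p e2 e2 = 0) (pL : left_preLie p).
Hypothesis char0 : [pchar k] =i pred0.
Let coords' := coordinates_swap coords.

(** The identity at (e1, e1, e2) says that e1 * (e1 * e2) is invariant. *)
Lemma preLie_own_coefficient_pure : exists h : H, bcoef c2 (p e1 e2) = h ⊗ 1.
Proof.
apply: (invariant_square_pure char0).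
rewrite -(coef_pprod_r_basis coords') // -coef_perm12; congr (bcoef c2 _).
have := pL e1 e1 e2; rewrite p11 pprod_l0 [RHS](morph_sub _ _ bpD).
by rewrite (zmod_morphism0 bpD) !sub0r => /oppr_inj.
Qed.

(** The identity at (e1, e2, e2), read along e1. *)
Lemma preLie_mixed_coefficient_eq0 (x : H) :
  bcoef c1 (p e2 e1) = x ⊗ 1 -> bcoef c1 (p e1 e2) = 0.
Proof.
move=> p21; apply: (@mixed_coefficient_eq0 _ _ char0 x).
have := congr1 (bcoef c1) (pL e1 e2 e2).
rewrite coef_perm12 !(morph_sub _ _ (@bcoefD _ _ _ _ c1)) p22 pprod_r0.
rewrite (zmod_morphism0 (@bcoefD _ _ _ _ c1)) subr0.
by rewrite !(coef_pprod_l_basis coords) // (coef_pprod_r_basis coords) // p21.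
Qed.

(** The identity at (e1, e2, e1), where only (e1 * e2) * e1 survives. *)
Lemma preLie_pure_exclusive (x y : H) :
  p e1 e2 = y ⊗ 1 ⊗H e2 -> p e2 e1 = x ⊗ 1 ⊗H e1 -> y = 0 \/ x = 0.
Proof.
move=> p12 p21; have [[c11 c12] [c21 c22] _] := coords.
apply: (pure_comul_eq0 char0).
have bcoef0 := zmod_morphism0 (@bcoefD _ _ (comul3 g) _ c1).
have pl0 : pprod_l p (p e2 e1) e1 = 0.
  by rewrite p21 pprod_lE p11 (zmod_morphism0 blD) scaler0.
have pr0 : pprod_r p e1 (p e2 e1) = 0.
  by rewrite p21 pprod_rE p11 (zmod_morphism0 brD) scaler0.
have := pL e1 e2 e1; rewrite pl0 pr0 p11 pprod_r0 subrr (zmod_morphism0 bpD) subr0.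
move/(congr1 (bcoef c1)); rewrite bcoef0 p12 coef_pprod_l p21 bcoefE c11.
by rewrite rmorph1 mulr1.
Qed.
End NecessaryConditions.

End Associator.

Theorem theorem3p8 (k : closedFieldType) (char0 : [pchar k] =i pred0)
    (delta : finLieAlgType k) (P : lmodType (U delta)) (e1 e2 : P)
    (basis : forall x : P, exists! c : U delta * U delta, x = c.1 *: e1 + c.2 *: e2)
    (p : pseudoproduct P) (e11 : p e1 e1 = 0) (e22 : p e2 e2 = 0) :
  left_preLie p <->
  [\/ p e1 e2 = 0 /\ p e2 e1 = 0,
      p e1 e2 = 0 /\ (exists2 g : U delta, g != 0 & p e2 e1 = g ⊗ 1 ⊗H e1)
    | (exists2 h : U delta, h != 0 & p e1 e2 = h ⊗ 1 ⊗H e2) /\ p e2 e1 = 0].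
Proof.
have [c1 [c2 coords]] := coordinates_exist basis.
have coords' := coordinates_swap coords.
have pure0 x : (0 : U delta) ⊗ (1 : U delta) ⊗H x = 0 :> tens2 P.
  by rewrite (zmod_morphism0 (fun a b => kpureDl a b (1 : U delta))) bpure0l.
split=> [pL|]; last first.
  case=> [[p12 p21]|[p12 [g _ p21]]|[[h _ p12] p21]].
  - by apply: (left_preLie_right_type coords (x := 0)) => //; rewrite p21 pure0.
  - exact: left_preLie_right_type coords _ _ p12 p21.
  - exact: left_preLie_right_type coords' _ _ p21 p12.
have [h b12] := preLie_own_coefficient_pure coords e11 pL char0.
have [g b21] := preLie_own_coefficient_pure coords' e22 pL char0.
have a12 := preLie_mixed_coefficient_eq0 coords e22 pL char0 b21.
have a21 := preLie_mixed_coefficient_eq0 coords' e11 pL char0 b12.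
have p12 : p e1 e2 = h ⊗ 1 ⊗H e2.
  by rewrite (tens2_decomposition coords (p e1 e2)) a12 b12 bpure0l add0r.
have p21 : p e2 e1 = g ⊗ 1 ⊗H e1.
  by rewrite (tens2_decomposition coords (p e2 e1)) a21 b21 bpure0l addr0.
have [h0|h0] := eqVneq h 0.
  have p12_0 : p e1 e2 = 0 by rewrite p12 h0 pure0.
  have [g0|g0] := eqVneq g 0; first by constructor 1; rewrite p21 g0 pure0.
  by constructor 2; split=> //; exists g.
have g0 : g = 0.
  have [h_eq0|//] := preLie_pure_exclusive coords e11 pL char0 p12 p21.
  by rewrite h_eq0 eqxx in h0.
by constructor 3; split; [exists h|rewrite p21 g0 pure0].
Qed.
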